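(* There is a commutative unital $C^*$-algebra $A$ that is computably presentable but not uniformly computably unital.
   Context: Fix an effective enumeration $(\mathfrak{p}_n)$ of the $*$-polynomials with coefficients in $\mathbb{Q}(i)$ in variables $x_0,x_1,\dots$. A presentation of a $C^*$-algebra $A$ is $A^\#=(A,(u_n)_{n\in\mathbb{N}})$ with $u_n\in A$ such that the rational vectors $\mathfrak{p}_n[A^\#]$ (substitute $u_j$ for $x_j$) are dense in $A$. Its diagram is $\{(r,j,r'): r,r'\in\mathbb{Q}\cap(0,\infty),\ r<\|\mathfrak{p}_j[A^\#]\|<r'\}$ and a name of $A^\#$ is $f\in\mathbb{N}^\mathbb{N}$ whose range is exactly the set of codes $\langle r,j,r'\rangle$ of diagram elements. $A^\#$ is computable if it has a computable name, and $A$ is computably presentable if it has a computable presentation. An index of a computable presentation $A^\#$ is an $e$ such that the $e$-th partial computable function $\phi_e$ is total and is a name of $A^\#$. An $A^\#$-index of a vector $v\in A$ is an index of a total computable function $k\mapsto m_k$ with $\|\mathfrak{p}_{m_k}[A^\#]-v\|<2^{-k}$ for all $k$. A unital $C^*$-algebra $A$ with unit $\mathbf{1}_A$ is uniformly computably unital if there is a partial computable function which, given any index $e$ of a computable presentation $A^\#$ of $A$, outputs an $A^\#$-index of $\mathbf{1}_A$. *)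

(* Defs.v *)
From Stdlib Require Cantor.
From HB Require Import structures.
From mathcomp Require Import all_boot all_order all_algebra.
From mathcomp Require Import complex.
From mathcomp Require Import all_classical all_reals all_analysis.
Set Implicit Arguments.
Unset Strict Implicit.
Unset Printing Implicit Defensive.
Import Order.TTheory GRing.Theory Num.Theory.
Import numFieldNormedType.Exports.
Local Open Scope classical_set_scope.
Local Open Scope ring_scope.

Definition npair (a b : nat) : nat := Cantor.to_nat (a, b).
Arguments npair : simpl never.
Notation "⟪ a , b ⟫" := (npair a b) (at level 0, a, b at level 99).
Definition pleft (n : nat) : nat := (Cantor.of_nat n).1.
Definition pright (n : nat) : nat := (Cantor.of_nat n).2.

Lemma pleftK a b : pleft ⟪a, b⟫ = a.
Proof. by rewrite /pleft /npair Cantor.cancel_of_to. Qed.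

Lemma prightK a b : pright ⟪a, b⟫ = b.
Proof. by rewrite /pright /npair Cantor.cancel_of_to. Qed.

Lemma pairK n : ⟪pleft n, pright n⟫ = n.
Proof. by rewrite /npair -surjective_pairing Cantor.cancel_to_of. Qed.

Lemma pair_inj a b a' b' : ⟪a, b⟫ = ⟪a', b'⟫ -> a = a' /\ b = b'.
Proof. by move/Cantor.to_nat_inj => [-> ->]. Qed.

(** Partial recursive functions of one argument. A function of several
    arguments is one of a coded tuple, which is why the pairing function and
    its projections are among the basic functions. *)

Inductive code : Type :=
| CZero
| CSucc
| CLeft
| CRight
| CPair of code & code
| CComp of code & code
| CPrec of code & code
| CMu of code.

(** [denote c] is the graph of the partial function computed by [c].
    [CPrec f g] sends <a,0> to f(a) and <a,k+1> to g<a,<k,y>>, where y is its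
    own value at <a,k>. [CMu f] sends a to the least v with f<a,v> = 0, all
    the values f<a,k> for k < v being defined. *)
Fixpoint denote (c : code) : nat -> nat -> Prop :=
  match c with
  | CZero => fun _ v => v = 0%N
  | CSucc => fun n v => v = n.+1
  | CLeft => fun n v => v = pleft n
  | CRight => fun n v => v = pright n
  | CPair f g => fun n v =>
      exists a b, [/\ denote f n a, denote g n b & v = ⟪a, b⟫]
  | CComp f g => fun n v => exists2 a, denote g n a & denote f a v
  | CPrec f g => fun n v => exists s : nat -> nat,
      [/\ denote f (pleft n) (s 0%N),
          forall k, (k < pright n)%N ->
            denote g ⟪pleft n, ⟪k, s k⟫⟫ (s k.+1)
        & v = s (pright n)]
  | CMu f => fun n v =>
      denote f ⟪n, v⟫ 0%N /\
      forall k, (k < v)%N -> exists y, denote f ⟪n, k⟫ y.+1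
  end.

Fixpoint godel (c : code) : nat :=
  match c with
  | CZero => ⟪0, 0⟫%N
  | CSucc => ⟪1, 0⟫%N
  | CLeft => ⟪2, 0⟫%N
  | CRight => ⟪3, 0⟫%N
  | CPair f g => ⟪4, ⟪godel f, godel g⟫⟫%N
  | CComp f g => ⟪5, ⟪godel f, godel g⟫⟫%N
  | CPrec f g => ⟪6, ⟪godel f, godel g⟫⟫%N
  | CMu f => ⟪7, godel f⟫%N
  end.

(** [phi e n v] says that the e-th partial computable function is defined at n
    with value v; it is nowhere defined if e is not a Gödel number. *)
Definition phi (e n v : nat) : Prop := exists2 c, godel c = e & denote c n v.

Lemma denote_fun c n v w : denote c n v -> denote c n w -> v = w.
Proof.
elim: c n v w => [||||f IHf g IHg|f IHf g IHg|f IHf g IHg|f IHf] n v w /=.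
- by move=> -> ->.
- by move=> -> ->.
- by move=> -> ->.
- by move=> -> ->.
- move=> [a [b [fa gb ->]]] [a' [b' [fa' gb' ->]]].
  by rewrite (IHf _ _ _ fa fa') (IHg _ _ _ gb gb').
- move=> [a ga fa] [b gb fb]; rewrite (IHg _ _ _ ga gb) in fa.
  exact: IHf fa fb.
- move=> [s [s0 sS ->]] [t [t0 tS ->]].
  suff st k : (k <= pright n)%N -> s k = t k by exact: st.
  elim: k => [_|k IHk kn]; first exact: IHf s0 t0.
  have := tS _ kn; rewrite -(IHk (ltnW kn)); exact: IHg (sS _ kn).
- move=> [fv ltv] [fw ltw]; case: (ltngtP v w) => // [vw|wv].
  + by have [y fy] := ltw _ vw; have := IHf _ _ _ fv fy.
  + by have [y fy] := ltv _ wv; have := IHf _ _ _ fw fy.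
Qed.

Lemma godel_inj : injective godel.
Proof.
elim=> [||||f IHf g IHg|f IHf g IHg|f IHf g IHg|f IHf]
  [||||f' g'|f' g'|f' g'|f'] //= /pair_inj[] //.
- by move=> _ /pair_inj[/IHf -> /IHg ->].
- by move=> _ /pair_inj[/IHf -> /IHg ->].
- by move=> _ /pair_inj[/IHf -> /IHg ->].
- by move=> _ /IHf ->.
Qed.

Lemma phi_fun e n v w : phi e n v -> phi e n w -> v = w.
Proof.
by move=> [c <- cv] [d /godel_inj -> dw]; apply: denote_fun cv dw.
Qed.

Definition index_of (e : nat) (f : nat -> nat) : Prop :=
  forall n, phi e n (f n).

Definition computable (f : nat -> nat) : Prop := exists e, index_of e f.

(** Complex *-polynomials without constant term in noncommuting variables.
    The letter (j, b) is x_j, starred iff b; a word is nonempty, given by its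
    first letter and the remaining ones; a polynomial is a formal sum of
    scalar multiples of words. Constant terms are excluded because the
    polynomials are evaluated in C*-algebras that need not have a unit. *)

Definition letter : Type := nat * bool.
Definition word : Type := letter * seq letter.
Definition starpoly : Type := seq (complex rat * word).

Definition int_enum (n : nat) : int := if odd n then Negz n./2 else Posz n./2.

Definition rat_enum (n : nat) : rat :=
  (int_enum (pleft n))%:~R / (pright n).+1%:R.

Definition qi_enum (n : nat) : complex rat :=
  Complex (rat_enum (pleft n)) (rat_enum (pright n)).

Definition letter_enum (n : nat) : letter := (n./2, odd n).

Definition word_enum (n : nat) : word :=
  (letter_enum (pleft n), map letter_enum (CodeSeq.decode (pright n))).

Definition monomial_enum (n : nat) : complex rat * word :=
  (qi_enum (pleft n), word_enum (pright n)).

Definition starpoly_enum (n : nat) : starpoly :=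
  map monomial_enum (CodeSeq.decode n).

Lemma map_decode_surj (T : Type) (f : nat -> T) :
  (forall x, exists n, f n = x) ->
  forall s, exists n, map f (CodeSeq.decode n) = s.
Proof.
move=> fS s; suff [t <-] : exists t, map f t = s.
  by exists (CodeSeq.code t); rewrite CodeSeq.codeK.
elim: s => [|x s [t <-]]; first by exists [::].
by have [n <-] := fS x; exists (n :: t).
Qed.

Lemma rat_enum_surj (q : rat) : exists n, rat_enum n = q.
Proof.
have [a aE] : exists a, int_enum a = numq q.
  case: (numq q) => k; first by exists k.*2; rewrite /int_enum odd_double doubleK.
  by exists k.*2.+1; rewrite /int_enum /= odd_double /= uphalf_double.
exists ⟪a, `|denq q|.-1⟫; rewrite /rat_enum pleftK prightK aE.
rewrite prednK ?absz_gt0 ?denq_neq0 // pmulrn absz_denq.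
exact: divq_num_den.
Qed.

Lemma letter_enum_surj (l : letter) : exists n, letter_enum n = l.
Proof.
case: l => j b; exists (b + j.*2)%N.
by rewrite /letter_enum half_bit_double oddD odd_double addbF oddb.
Qed.

Lemma starpoly_enum_surj (p : starpoly) : exists n, starpoly_enum n = p.
Proof.
apply: map_decode_surj p => -[[a b] [l w]].
have [na <-] := rat_enum_surj a; have [nb <-] := rat_enum_surj b.
have [nl <-] := letter_enum_surj l.
have [nw <-] := map_decode_surj letter_enum_surj w.
exists ⟪⟪na, nb⟫, ⟪nl, nw⟫⟫.
by rewrite /monomial_enum /qi_enum /word_enum !(pleftK, prightK).
Qed.

(** C*-algebras, not assumed unital. Norms take their values in R[i], whose
    order makes 0 <= z mean that z is a nonnegative real. *)
HB.mixin Record CompleteNormedModule_isCStarAlgebra (R : realType) A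
    of CompleteNormedModule R[i] A := {
  cmul : A -> A -> A;
  cstar : A -> A;
  cmulA : associative cmul;
  cmulDl : left_distributive cmul +%R;
  cmulDr : right_distributive cmul +%R;
  cscaleAl : forall (a : R[i]) (x y : A), a *: cmul x y = cmul (a *: x) y;
  cscaleAr : forall (a : R[i]) (x y : A), a *: cmul x y = cmul x (a *: y);
  cstarK : involutive cstar;
  cstarD : forall x y : A, cstar (x + y) = cstar x + cstar y;
  cstarZ : forall (a : R[i]) (x : A), cstar (a *: x) = Num.conj a *: cstar x;
  cstarM : forall x y : A, cstar (cmul x y) = cmul (cstar y) (cstar x);
  cnormM : forall x y : A, `|cmul x y| <= `|x| * `|y|;
  cnorm_starM : forall x : A, `|cmul (cstar x) x| = `|x| ^+ 2 }.

#[short(type="cstarAlgType")]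
HB.structure Definition CStarAlgebra (R : realType) :=
  { A of CompleteNormedModule_isCStarAlgebra R A
       & CompleteNormedModule R[i] A }.

Section Presentations.
Variables (R : realType) (A : cstarAlgType R).

Definition is_cunit (e : A) : Prop :=
  forall x : A, cmul e x = x /\ cmul x e = x.

Definition qi_embed (z : complex rat) : R[i] :=
  Complex (ratr (complex.Re z)) (ratr (complex.Im z)).

Definition letter_eval (u : nat -> A) (l : letter) : A :=
  if l.2 then cstar (u l.1) else u l.1.

Definition word_eval (u : nat -> A) (w : word) : A :=
  foldl (fun x l => cmul x (letter_eval u l)) (letter_eval u w.1) w.2.

Definition starpoly_eval (u : nat -> A) (p : starpoly) : A :=
  \sum_(m <- p) qi_embed m.1 *: word_eval u m.2.

Definition rational_vector (u : nat -> A) (n : nat) : A :=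
  starpoly_eval u (starpoly_enum n).

Record presentation : Type := Presentation {
  generator :> nat -> A;
  rational_vectors_dense : dense (range (rational_vector generator)) }.

Definition diagram (P : presentation) : set (rat * nat * rat) :=
  [set t | let: (r, j, r') := t in
     [/\ 0 < r, 0 < r', ratr r < `|rational_vector P j|
       & `|rational_vector P j| < ratr r']].

(** Rationals are coded by their numerator and denominator in lowest terms;
    the coding is only used for positive rationals. *)
Definition rat_code (r : rat) : nat := ⟪absz (numq r), absz (denq r)⟫.

Definition triple_code (t : rat * nat * rat) : nat :=
  let: (r, j, r') := t in ⟪rat_code r, ⟪j, rat_code r'⟫⟫.

Definition is_name (P : presentation) (f : nat -> nat) : Prop :=
  range f = triple_code @` diagram P.

Definition computable_presentation (P : presentation) : Prop :=
  exists2 f, computable f & is_name P f.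

Definition computably_presentable : Prop :=
  exists P, computable_presentation P.

Definition presentation_index (P : presentation) (e : nat) : Prop :=
  exists2 f, index_of e f & is_name P f.

Definition vector_index (P : presentation) (v : A) (i : nat) : Prop :=
  exists2 m, index_of i m &
    forall k, `|rational_vector P (m k) - v| < (2 ^- k : R[i]).

(** [one] is meant to be the unit of the algebra. *)
Definition uniformly_computably_unital (one : A) : Prop :=
  exists a, forall (P : presentation) (e : nat), presentation_index P e ->
    exists2 i, phi a e i & vector_index P one i.

End Presentations.

Arguments computably_presentable {R} A.

(* Main.v *)
From Stdlib Require Cantor.
Require Import Defs.
From HB Require Import structures.
From mathcomp Require Import all_boot all_order all_algebra.
From mathcomp Require Import complex.
From mathcomp Require Import all_classical all_reals all_analysis.
From mathcomp Require Import zify ring lra.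
Set Implicit Arguments.
Unset Strict Implicit.
Unset Printing Implicit Defensive.
Import Order.TTheory GRing.Theory Num.Theory.
Import numFieldNormedType.Exports.

(** The algebra is [c], the convergent sequences of complex numbers. For a set
    [E] of at most one index put [u_0 = 1 - 1_E] and [u_(k+1) = delta_k]; these
    elements generate [c]. A polynomial [p_j] involves only variables of index
    below [j], so its values at the indices [k >= j] are 0 if [k] is in [E] and
    a constant otherwise; its norm is therefore the maximum of [|p_j(k)|] over
    [k < j + 2], and the diagram is decidable as soon as [E] is. If
    [E = {s}] then [p_m] vanishes at [s] for all [m <= s], so that it is far
    from the unit.

    For a number [x], let [E_x] consist of the least [s = <t, v>] such that [t]
    witnesses [phi_x(x) = v]. If the unit could be computed uniformly, some
    [m : nat -> nat] computed by a program [b] would satisfy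
    [|p_(m x) - 1| < 1/2] in the presentation given by [E_x], for all [x]. At
    [x = b] the set [E_b] is a singleton [{s}] with [s >= m b], which is
    absurd. *)

(** * Total recursive functions *)

Local Open Scope nat_scope.

Lemma pleft_le n : pleft n <= n.
Proof.
rewrite -{2}[n]pairK /npair.
by have := Cantor.to_nat_non_decreasing (pleft n) (pright n); lia.
Qed.

Lemma pright_le n : pright n <= n.
Proof.
rewrite -{2}[n]pairK /npair.
by have := Cantor.to_nat_non_decreasing (pleft n) (pright n); lia.
Qed.

Definition recfun (f : nat -> nat) : Prop := exists c, forall n, denote c n (f n).

Definition recfun2 (f : nat -> nat -> nat) : Prop :=
  recfun (fun z => f (pleft z) (pright z)).

(** The nesting [⟪x, ⟪k, y⟫⟫] is that of the argument which [CPrec] passes to its step function. *)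
Definition recfun3 (f : nat -> nat -> nat -> nat) : Prop :=
  recfun (fun z => f (pleft z) (pleft (pright z)) (pright (pright z))).

Lemma recfun_comp f g : recfun f -> recfun g -> recfun (fun n => f (g n)).
Proof.
move=> [c cf] [d dg]; exists (CComp c d) => n /=.
by exists (g n).
Qed.

Lemma recfun_pair f g : recfun f -> recfun g -> recfun (fun n => ⟪f n, g n⟫).
Proof.
by move=> [c cf] [d dg]; exists (CPair c d) => n /=; exists (f n), (g n).
Qed.

Lemma recfun_left f : recfun f -> recfun (fun n => pleft (f n)).
Proof. by apply: (@recfun_comp pleft); exists CLeft. Qed.

Lemma recfun_right f : recfun f -> recfun (fun n => pright (f n)).
Proof. by apply: (@recfun_comp pright); exists CRight. Qed.

Lemma recfun_succ f : recfun f -> recfun (fun n => (f n).+1).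
Proof. by apply: (@recfun_comp succn); exists CSucc. Qed.

Definition code_id := CPair CLeft CRight.

Lemma denote_id n : denote code_id n n.
Proof. by exists (pleft n), (pright n); rewrite pairK. Qed.

Lemma recfun_id : recfun (fun n => n).
Proof. by exists code_id => n; exact: denote_id. Qed.

Fixpoint code_const k :=
  if k is k'.+1 then CComp CSucc (code_const k') else CZero.

Lemma denote_const k n : denote (code_const k) n k.
Proof. by elim: k => //= k IHk; exists k. Qed.

Lemma recfun_const k : recfun (fun=> k).
Proof. by exists (code_const k) => n; exact: denote_const. Qed.

Lemma recfun2_app h f g : recfun2 h -> recfun f -> recfun g ->
  recfun (fun x => h (f x) (g x)).
Proof.
move=> ch cf cg; have := recfun_comp ch (recfun_pair cf cg).
by congr recfun; apply/funext => x; rewrite pleftK prightK.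
Qed.

Lemma recfun3_app h f g k : recfun3 h -> recfun f -> recfun g -> recfun k ->
  recfun (fun x => h (f x) (g x) (k x)).
Proof.
move=> ch cf cg ck; have := recfun_comp ch (recfun_pair cf (recfun_pair cg ck)).
by congr recfun; apply/funext => x; rewrite pleftK !prightK pleftK.
Qed.

Definition iterate (a : nat) (h : nat -> nat -> nat) (b : nat) : nat :=
  nat_rect (fun=> nat) a h b.

(** Primitive recursion in which the parameter [x] travels in the left component; the bound [b x] is
    substituted afterwards. *)
Lemma recfun_iterate a b h : recfun a -> recfun b -> recfun3 h ->
  recfun (fun x => iterate (a x) (h x) (b x)).
Proof.
move=> [ca ha] cb [ch hh].
have crec : recfun (fun z => iterate (a (pleft z)) (h (pleft z)) (pright z)).
  exists (CPrec ca ch) => n /=.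
  exists (iterate (a (pleft n)) (h (pleft n))); split=> [|k _|//].
    exact: ha.
  by have := hh ⟪pleft n, ⟪k, iterate (a (pleft n)) (h (pleft n)) k⟫⟫;
    rewrite !(pleftK, prightK).
have := recfun_comp crec (recfun_pair recfun_id cb).
by congr recfun; apply/funext => x; rewrite pleftK prightK.
Qed.

(** A recursion whose step returns its counter ends with the last counter value, and with the
    initial 0 if there is no step. *)
Lemma recfun_pred f : recfun f -> recfun (fun x => (f x).-1).
Proof.
move=> cf.
have c : recfun3 (fun _ k _ => k) by exact/recfun_left/recfun_right/recfun_id.
have := recfun_iterate (recfun_const 0) cf c.
by congr recfun; apply/funext => x; case: (f x).
Qed.

Lemma recfun_add f g : recfun f -> recfun g -> recfun (fun x => f x + g x).
Proof.
move=> cf cg.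
have c : recfun3 (fun _ _ y => y.+1) by exact/recfun_succ/recfun_right/recfun_right/recfun_id.
have := recfun_iterate cf cg c.
by congr recfun; apply/funext => x; elim: (g x) => [|n /= ->]; rewrite ?addn0 ?addnS.
Qed.

Lemma recfun_sub f g : recfun f -> recfun g -> recfun (fun x => f x - g x).
Proof.
move=> cf cg.
have c : recfun3 (fun _ _ y => y.-1) by exact/recfun_pred/recfun_right/recfun_right/recfun_id.
have := recfun_iterate cf cg c.
by congr recfun; apply/funext => x; elim: (g x) => [|n /= ->]; rewrite ?subn0 ?subnS.
Qed.

Lemma recfun_mul f g : recfun f -> recfun g -> recfun (fun x => f x * g x).
Proof.
move=> cf cg.
have c : recfun3 (fun x _ y => f x + y).
  apply: recfun_add; last exact/recfun_right/recfun_right/recfun_id.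
  exact/recfun_comp/recfun_left/recfun_id.
have := recfun_iterate (recfun_const 0) cg c.
by congr recfun; apply/funext => x; elim: (g x) => [|n /= ->]; rewrite ?muln0 ?mulnS.
Qed.

Lemma recfun_expn f g : recfun f -> recfun g -> recfun (fun x => f x ^ g x).
Proof.
move=> cf cg.
have c : recfun3 (fun x _ y => f x * y).
  apply: recfun_mul; last exact/recfun_right/recfun_right/recfun_id.
  exact/recfun_comp/recfun_left/recfun_id.
have := recfun_iterate (recfun_const 1) cg c.
by congr recfun; apply/funext => x; elim: (g x) => [|n /= ->]; rewrite ?expn0 ?expnS.
Qed.

(** * Decidable predicates, bounded quantifiers and search *)

Definition recpred (b : nat -> bool) : Prop := recfun (fun x => nat_of_bool (b x)).

Lemma recpred_const b : recpred (fun=> b).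
Proof. exact: recfun_const. Qed.

Lemma recpred_eq0 f : recfun f -> recpred (fun x => f x == 0).
Proof.
move=> cf; have := recfun_sub (recfun_const 1) cf.
by congr recfun; apply/funext => x; case: (f x).
Qed.

Lemma recpred_neg b : recpred b -> recpred (fun x => ~~ b x).
Proof.
move=> cb; have := recfun_sub (recfun_const 1) cb.
by congr recfun; apply/funext => x; case: (b x).
Qed.

Lemma recpred_and b c : recpred b -> recpred c -> recpred (fun x => b x && c x).
Proof.
move=> cb cc; have := recfun_mul cb cc.
by congr recfun; apply/funext => x; case: (b x); case: (c x).
Qed.

Lemma recpred_or b c : recpred b -> recpred c -> recpred (fun x => b x || c x).
Proof.
move=> cb cc; have := recpred_neg (recpred_and (recpred_neg cb) (recpred_neg cc)).
by congr recfun; apply/funext => x; case: (b x); case: (c x).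
Qed.

Lemma recpred_imp b c : recpred b -> recpred c -> recpred (fun x => b x ==> c x).
Proof.
move=> cb cc; have := recpred_or (recpred_neg cb) cc.
by congr recfun; apply/funext => x; case: (b x); case: (c x).
Qed.

Lemma recpred_leq f g : recfun f -> recfun g -> recpred (fun x => f x <= g x).
Proof. by move=> cf cg; exact/recpred_eq0/recfun_sub. Qed.

Lemma recpred_eq f g : recfun f -> recfun g -> recpred (fun x => f x == g x).
Proof.
move=> cf cg; have := recpred_and (recpred_leq cf cg) (recpred_leq cg cf).
by congr recfun; apply/funext => x; rewrite eqn_leq.
Qed.

Lemma recfun_if b f g : recpred b -> recfun f -> recfun g ->
  recfun (fun x => if b x then f x else g x).
Proof.
move=> cb cf cg.
have := recfun_add (recfun_mul cb cf) (recfun_mul (recpred_neg cb) cg).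
congr recfun; apply/funext => x.
by case: (b x) => /=; rewrite ?(mul0n, mul1n, addn0).
Qed.

Lemma recpred_if (b c d : nat -> bool) : recpred b -> recpred c -> recpred d ->
  recpred (fun x => if b x then c x else d x).
Proof.
move=> cb cf cg; have := recfun_if cb cf cg.
by congr recfun; apply/funext => x; case: (b x).
Qed.

(** A bounded universal quantifier is a product of truth values, accumulated by recursion up to the
    bound. *)
Lemma recpred_all (p : nat -> nat -> bool) b : recfun b ->
  recpred (fun z => p (pleft z) (pright z)) ->
  recpred (fun x => all (p x) (iota 0 (b x))).
Proof.
move=> cb cp.
have c : recfun3 (fun x k y => y * p x k).
  apply: recfun_mul; first exact/recfun_right/recfun_right/recfun_id.
  apply: (@recfun2_app p); first exact: cp.
    exact/recfun_left/recfun_id.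
  exact/recfun_left/recfun_right/recfun_id.
have := recfun_iterate (recfun_const 1) cb c.
congr recfun; apply/funext => x; elim: (b x) => // n IHn.
rewrite -[in RHS]addn1 iotaD all_cat /= andbT add0n [LHS]/= IHn.
by case: (all _ _); case: (p x n).
Qed.

Lemma recpred_has (p : nat -> nat -> bool) b : recfun b ->
  recpred (fun z => p (pleft z) (pright z)) ->
  recpred (fun x => has (p x) (iota 0 (b x))).
Proof.
move=> cb cp; have := recpred_neg (@recpred_all (fun x k => ~~ p x k) b cb (recpred_neg cp)).
by congr recfun; apply/funext => x; rewrite -has_predC has_predC all_predC negbK.
Qed.

Lemma recfun_mu (p : nat -> nat -> bool) :
  recpred (fun z => p (pleft z) (pright z)) -> (forall x, exists y, p x y) ->
  exists2 f, recfun f & forall x, p x (f x).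
Proof.
(* [CMu] looks for a zero, so the search runs over the negation of [p], whose value is 1 below the
   minimum. *)
move=> cp px; have [c hc] := recpred_neg cp.
exists (fun x => ex_minn (px x)); last by move=> x; case: ex_minnP.
exists (CMu c) => n /=; case: ex_minnP => m pm minm; split.
  by have := hc ⟪n, m⟫; rewrite pleftK prightK pm.
move=> k km; exists 0; have := hc ⟪n, k⟫; rewrite pleftK prightK.
case: (boolP (p n k)) => // /minm; lia.
Qed.

(** The half of [x] is the only [y] with [x = 2 y] or [x = 2 y + 1], so searching for such a [y]
    finds it. *)
Lemma recfun_half f : recfun f -> recfun (fun x => (f x)./2).
Proof.
move=> cf; apply: (@recfun_comp half) => //.
have [||g cg gP] := @recfun_mu (fun x y => (x == y + y) || (x == (y + y).+1)).
- apply: recpred_or; apply: recpred_eq; try apply: recfun_succ; try apply: recfun_add;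
  exact/recfun_left/recfun_id || exact/recfun_right/recfun_id.
- by move=> x; exists x./2; lia.
have -> // : half = g by apply/funext => x; have := gP x; lia.
Qed.

Lemma recpred_odd f : recfun f -> recpred (fun x => odd (f x)).
Proof.
move=> cf; have := recpred_neg (recpred_eq (recfun_add (recfun_half cf) (recfun_half cf)) cf).
by congr recfun; apply/funext => x; congr nat_of_bool; lia.
Qed.

(** * Lists coded by numbers *)

Definition decode_head n := head 0 (CodeSeq.decode n).
Definition decode_tail n := CodeSeq.code (behead (CodeSeq.decode n)).

(** [CodeSeq] codes the empty list by 0 and [k :: s] by [2 ^ k * (2 * m + 1)], where [m] is the code
    of [s]. *)
Lemma decode_decomp n k m : n = 2 ^ k * m.*2.+1 ->
  decode_head n = k /\ decode_tail n = m.
Proof.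
move=> ->; have -> : 2 ^ k * m.*2.+1 = CodeSeq.code (k :: CodeSeq.decode m).
  by rewrite /= CodeSeq.decodeK.
by rewrite /decode_head /decode_tail CodeSeq.codeK /= CodeSeq.decodeK.
Qed.

(** A positive number determines its factors [2 ^ k] and [2 * m + 1], so one search yields head and
    tail together. The code 0 is sent to [⟪0, 0⟫], in agreement with the default head and the empty
    tail. *)
Lemma recfun_decode : recfun decode_head /\ recfun decode_tail.
Proof.
have [||g cg gP] := @recfun_mu (fun x y => (x == 0) && (y == ⟪0, 0⟫) ||
  (x == 2 ^ (pleft y) * (pright y + pright y).+1)).
- apply: recpred_or.
    by apply: recpred_and; apply: recpred_eq;
      [exact/recfun_left/recfun_id|exact/recfun_const|exact/recfun_right/recfun_id|exact/recfun_const].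
  apply: recpred_eq; first exact/recfun_left/recfun_id.
  apply: recfun_mul.
    by apply: recfun_expn; [exact: recfun_const|exact/recfun_left/recfun_right/recfun_id].
  by apply/recfun_succ/recfun_add; exact/recfun_right/recfun_right/recfun_id.
- move=> x; case: (posnP x) => [->|x0]; first by exists ⟪0, 0⟫.
  exists ⟪decode_head x, decode_tail x⟫; rewrite pleftK prightK.
  apply/orP; right; apply/eqP; rewrite addnn.
  rewrite -{1}[x]CodeSeq.decodeK /decode_head /decode_tail.
  have : CodeSeq.decode x != [::].
    by apply/eqP => h; rewrite -[x]CodeSeq.decodeK h in x0.
  by case: (CodeSeq.decode x).
have gE x : decode_head x = pleft (g x) /\ decode_tail x = pright (g x).
  have /orP[/andP[/eqP-> /eqP->]|/eqP] := gP x; first by rewrite pleftK prightK.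
  by rewrite addnn; apply: decode_decomp.
by split; [move: (recfun_left cg)|move: (recfun_right cg)]; congr recfun;
  apply/funext => x; rewrite ?(gE x).1 ?(gE x).2.
Qed.

Lemma size_decode n : size (CodeSeq.decode n) <= n.
Proof.
rewrite -{2}[n]CodeSeq.decodeK; elim: (CodeSeq.decode n) => //= k s IHs.
have : 0 < 2 ^ k by rewrite expn_gt0.
nia.
Qed.

Lemma recfun_foldl (g : nat -> nat -> nat -> nat) i l : recfun3 g -> recfun i -> recfun l ->
  recfun (fun x => foldl (g x) (i x) (CodeSeq.decode (l x))).
Proof.
move=> cg ci cl; have [chd ctl] := recfun_decode.
(* The loop state pairs the accumulator with the code of the remaining list. It stalls at the empty
   list, so any bound on the length may serve as the number of rounds; the code itself is one. *)
pose step x (k y : nat) := if pright y == 0 then y else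
  ⟪g x (pleft y) (decode_head (pright y)), decode_tail (pright y)⟫.
have cstep : recfun3 step.
  have cx : recfun (fun z => pleft z) by exact/recfun_left/recfun_id.
  have cy : recfun (fun z => pright (pright z)) by exact/recfun_right/recfun_right/recfun_id.
  apply: recfun_if => //; first exact/recpred_eq/recfun_const/recfun_right.
  apply: recfun_pair; last exact: (recfun_comp ctl (recfun_right cy)).
  by apply: (recfun3_app cg) => //; [exact/recfun_left|exact/(recfun_comp chd)/recfun_right].
have := recfun_left (recfun_iterate (recfun_pair ci cl) cl cstep).
congr recfun; apply/funext => x.
suff H n s a : size s <= n ->
    exists2 b, b = foldl (g x) a s &
      iterate ⟪a, CodeSeq.code s⟫ (step x) n = ⟪b, 0⟫.
  have [b <-] := H (l x) _ (i x) (size_decode (l x)).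
  by rewrite CodeSeq.decodeK => ->; rewrite pleftK.
(* [iterate] unfolds at its last round, whereas the list is consumed from the first. The two agree
   because [step] ignores its counter. *)
have iterS y k : iterate y (step x) k.+1 = iterate (step x 0 y) (step x) k.
  by elim: k => //= k ->.
have stop b k : iterate ⟪b, 0⟫ (step x) k = ⟪b, 0⟫.
  by elim: k => //= k ->; rewrite /step prightK eqxx.
elim: n s a => [|n IHn] [|k s] a //= sn.
- by exists a.
- by exists a => //; exact: stop n.+1.
have [|b bE bP] := IHn s (g x a k); first by [].
exists b => //; rewrite -bP.
transitivity (iterate (step x 0 ⟪a, CodeSeq.code (k :: s)⟫) (step x) n).
  exact: iterS.
congr iterate.
rewrite /step prightK pleftK.
have -> : (CodeSeq.code (k :: s) == 0) = false.
  by apply/eqP => /=; have : 0 < 2 ^ k by [rewrite expn_gt0]; nia.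
by rewrite /decode_head /decode_tail CodeSeq.codeK.
Qed.

Lemma recpred_all_decode (p : nat -> nat -> bool) l : recfun l ->
  recpred (fun z => p (pleft z) (pright z)) ->
  recpred (fun x => all (p x) (CodeSeq.decode (l x))).
Proof.
move=> cl cp.
have c : recfun3 (fun x y k => y * p x k).
  apply: recfun_mul; first exact/recfun_left/recfun_right/recfun_id.
  apply: (@recfun2_app p); first exact: cp.
    exact/recfun_left/recfun_id.
  exact/recfun_right/recfun_right/recfun_id.
have := recfun_foldl c (recfun_const 1) cl.
congr recfun; apply/funext => x.
rewrite -[RHS]mul1n; elim: (CodeSeq.decode _) 1 => /= [|k s IHs] a; first by rewrite muln1.
by rewrite IHs -mulnA; case: (p x k); case: (all _ _).
Qed.

Lemma recpred_mem_decode f l : recfun f -> recfun l ->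
  recpred (fun x => f x \in CodeSeq.decode (l x)).
Proof.
move=> cf cl.
have := recpred_neg (@recpred_all_decode (fun x k => k != f x) l cl
  (recpred_neg (recpred_eq (recfun_right recfun_id) (recfun_comp cf (recfun_left recfun_id))))).
congr recfun; apply/funext => x; congr nat_of_bool.
by rewrite -has_predC -has_pred1; apply: eq_has => k /=; rewrite negbK.
Qed.

Ltac rec_step := cbv beta; match goal with
  | |- recfun (fun x => x) => exact: recfun_id
  | |- recfun (fun _ => ?k) => exact: recfun_const
  | |- recpred (fun _ => ?b) => exact: recpred_const
  | |- recfun (fun x => pleft (@?f x)) => apply: (@recfun_left f)
  | |- recfun (fun x => pright (@?f x)) => apply: (@recfun_right f)
  | |- recfun (fun x => npair (@?f x) (@?g x)) => apply: (@recfun_pair f g)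
  | |- recfun (fun x => (@?f x).+1) => apply: (@recfun_succ f)
  | |- recfun (fun x => (@?f x).-1) => apply: (@recfun_pred f)
  | |- recfun (fun x => (@?f x)./2) => apply: (@recfun_half f)
  | |- recfun (fun x => @?f x + @?g x) => apply: (@recfun_add f g)
  | |- recfun (fun x => @?f x - @?g x) => apply: (@recfun_sub f g)
  | |- recfun (fun x => @?f x * @?g x) => apply: (@recfun_mul f g)
  | |- recfun (fun x => nat_of_bool (@?b x)) => change (recpred b)
  | |- recpred (fun x => ~~ @?b x) => apply: (@recpred_neg b)
  | |- recpred (fun x => @?b x && @?c x) => apply: (@recpred_and b c)
  | |- recpred (fun x => @?b x || @?c x) => apply: (@recpred_or b c)
  | |- recpred (fun x => @?b x ==> @?c x) => apply: (@recpred_imp b c)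
  | |- recpred (fun x => @?f x == @?g x) => apply: (@recpred_eq f g)
  | |- recpred (fun x => @?f x <= @?g x) => apply: (@recpred_leq f g)
  | |- recpred (fun x => odd (@?f x)) => apply: (@recpred_odd f)
  | |- recpred (fun x => in_mem (@?f x) (mem (CodeSeq.decode (@?l x)))) =>
      apply: (@recpred_mem_decode f l)
  | |- recpred (fun x => all (@?p x) (iota 0 (@?b x))) => apply: (@recpred_all p b)
  | |- recpred (fun x => has (@?p x) (iota 0 (@?b x))) => apply: (@recpred_has p b)
  | |- recpred (fun x => all (@?p x) (CodeSeq.decode (@?b x))) =>
      apply: (@recpred_all_decode p b)
  | |- recfun pleft => exact: (recfun_left recfun_id)
  | |- recfun pright => exact: (recfun_right recfun_id)
  (* Ltac patterns cannot mention a conditional, hence this fallback. *)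
  | |- recfun _ => apply: recfun_if
  | |- recpred _ => apply: recpred_if
  end.

Ltac rec_auto := repeat rec_step.

(** * Derivations of values of partial recursive functions *)

Section Derivations.
Implicit Types (s : seq nat) (e n v : nat).

(** A number [⟪e, ⟪n, v⟫⟫] is read as the assertion that program [e] sends [n] to [v]; a list [s] of
    numbers is a finite set of such assertions. *)
Definition fact s e n v : bool := ⟪e, ⟪n, v⟫⟫ \in s.

(** The eight cases follow the tags of [godel]. *)
Definition justified s (z : nat) : Prop :=
  let e := pleft z in let n := pleft (pright z) in let v := pright (pright z) in
  let k := pleft e in let a := pright e in
  [\/ [\/ e = ⟪0, 0⟫ /\ v = 0, e = ⟪1, 0⟫ /\ v = n.+1,
          e = ⟪2, 0⟫ /\ v = pleft n | e = ⟪3, 0⟫ /\ v = pright n],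
      [\/ [/\ k = 4, fact s (pleft a) n (pleft v) & fact s (pright a) n (pright v)] |
          k = 5 /\ exists2 y, fact s (pright a) n y & fact s (pleft a) y v],
      k = 6 /\ (if pright n == 0 then is_true (fact s (pleft a) (pleft n) v)
        else exists2 y, fact s e ⟪pleft n, (pright n).-1⟫ y &
          fact s (pright a) ⟪pleft n, ⟪(pright n).-1, y⟫⟫ v) |
      [/\ k = 7, fact s a ⟪n, v⟫ 0 &
          forall i, i < v -> exists y, fact s a ⟪n, i⟫ y.+1]].

(** Circular justifications do no harm: a fact is justified by facts about
    smaller programs, or about the same recursion at a smaller argument. *)
Definition derivation s : Prop := forall z, z \in s -> justified s z.

(** Facts occur only positively in [justified]. *)
Lemma justified_sub s s' z : {subset s <= s'} -> justified s z -> justified s' z.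
Proof.
move=> ss'; have sub e n v : fact s e n v -> fact s' e n v by exact: ss'.
case=> [?|[[k4 f g]|[k5 [y f g]]]|[k6 h]|[k7 h hk]].
- by constructor 1.
- by constructor 2; left; split=> //; exact: sub.
- by constructor 2; right; split=> //; exists y; exact: sub.
- constructor 3; split=> //; case: ifPn h => _; first exact: sub.
  by move=> [y f g]; exists y; exact: sub.
- constructor 4; split=> //; first exact: sub.
  by move=> i /hk[y f]; exists y; exact: sub.
Qed.

Lemma derivation_cat s s' : derivation s -> derivation s' -> derivation (s ++ s').
Proof.
move=> ds ds' z; rewrite mem_cat => /orP[/ds|/ds'];
by apply: justified_sub => x; rewrite mem_cat => ->; rewrite ?orbT.
Qed.

Lemma derivation_cons s z : derivation s -> justified s z -> derivation (z :: s).
Proof.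
have sub : {subset s <= z :: s} by move=> x; rewrite inE orbC => ->.
move=> ds jz x; rewrite inE => /orP[/eqP ->|/ds jx].
  exact: justified_sub sub jz.
exact: justified_sub sub jx.
Qed.

(** Induction on the program: the tag of its Gödel number leaves a single possible justification,
    which refers to subprograms. Only primitive recursion refers to itself, and there an inner
    induction on the argument takes over. *)
Lemma derivation_sound s c n v : derivation s -> fact s (godel c) n v -> denote c n v.
Proof.
move=> ds; elim: c n v => [||||f IHf g IHg|f IHf g IHg|f IHf g IHg|f IHf] n v h;
  move: (ds _ h); rewrite /justified !(pleftK, prightK) /=.
- case.
  + by case=> -[/pair_inj[]].
  + by case=> [[]|[]].
  + by case.
  + by case.
- case.
  + by case=> -[/pair_inj[]].
  + by case=> [[]|[]].
  + by case.
  + by case.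
- case.
  + by case=> -[/pair_inj[]].
  + by case=> [[]|[]].
  + by case.
  + by case.
- case.
  + by case=> -[/pair_inj[]].
  + by case=> [[]|[]].
  + by case.
  + by case.
- case.
  + by case=> -[/pair_inj[]].
  + case=> [[_ /IHf fa /IHg gb]|[]//].
    by exists (pleft v), (pright v); rewrite pairK.
  + by case.
  + by case.
- case.
  + by case=> -[/pair_inj[]].
  + case=> [[]//|[_ [y /IHg gy /IHf fy]]].
    by exists y.
  + by case.
  + by case.
- move=> _.
  suff H k a w : fact s (godel (CPrec f g)) ⟪a, k⟫ w -> exists t : nat -> nat,
      [/\ denote f a (t 0), forall i, i < k -> denote g ⟪a, ⟪i, t i⟫⟫ (t i.+1)
        & w = t k].
    by apply: H; rewrite pairK.
  elim: k w => [|k IHk] w hk; move: (ds _ hk); rewrite /justified /= !(pleftK, prightK);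
    case; rewrite ?(pleftK, prightK); try by case=> -[/pair_inj[]].
  + by case=> [[]|[]].
  + by move=> [_ /= /IHf fw]; exists (fun=> w).
  + by case.
  + by case=> [[]|[]].
  + move=> [_ /= [y /IHk[t [t0 tS yE]] /IHg gy]].
    (* The course of values up to [k] is extended by the new value [w]. *)
    exists (fun i => if i == k.+1 then w else t i); rewrite eqxx; split=> // i.
    rewrite ltnS => ik; rewrite eqSS ltn_eqF//.
    have [->|ik'] := eqVneq i k; first by rewrite -yE.
    by apply: tS; rewrite ltn_neqAle ik' ik.
  + by case.
- case.
  + by case=> -[/pair_inj[]].
  + by case=> [[]|[]].
  + by case.
  + move=> [_ /IHf f0 fk]; split=> // k /fk[y /IHf fy].
    by exists y.
Qed.

(** The derivations of the subcomputations are concatenated and the new fact is put in front;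
    recursion and minimization collect theirs by induction on the number of rounds. *)
Lemma derivation_complete c n v : denote c n v ->
  exists2 s, derivation s & fact s (godel c) n v.
Proof.
have base z : justified [::] z -> exists2 s, derivation s & z \in s.
  by move=> jz; exists [:: z]; rewrite ?mem_head//; exact: derivation_cons.
have add s z : derivation s -> justified s z -> exists2 s, derivation s & z \in s.
  by move=> ds jz; exists (z :: s); rewrite ?mem_head//; exact: derivation_cons.
have inl s1 s2 z : z \in s1 -> z \in s1 ++ s2 by rewrite mem_cat => ->.
have inr s1 s2 z : z \in s2 -> z \in s1 ++ s2 by rewrite mem_cat orbC => ->.
elim: c n v => [||||f IHf g IHg|f IHf g IHg|f IHf g IHg|f IHf] n v /=.
- move=> ->; apply: base; rewrite /justified !(pleftK, prightK).
  by constructor 1; constructor 1.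
- move=> ->; apply: base; rewrite /justified !(pleftK, prightK).
  by constructor 1; constructor 2.
- move=> ->; apply: base; rewrite /justified !(pleftK, prightK).
  by constructor 1; constructor 3.
- move=> ->; apply: base; rewrite /justified !(pleftK, prightK).
  by constructor 1; constructor 4.
- move=> [a [b [/IHf[s1 d1 f1] /IHg[s2 d2 f2] ->]]].
  apply: (add _ _ (derivation_cat d1 d2)).
  rewrite /justified !(pleftK, prightK); constructor 2; left; split=> //.
    exact: inl.
  exact: inr.
- move=> [a /IHg[s1 d1 f1] /IHf[s2 d2 f2]].
  apply: (add _ _ (derivation_cat d1 d2)).
  rewrite /justified !(pleftK, prightK); constructor 2; right; split=> //.
  by exists a; [exact: inl|exact: inr].
- move=> [t [/IHf[s0 d0 f0] tS ->]].
  suff H k : k <= pright n -> exists2 s, derivation s &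
      fact s (godel (CPrec f g)) ⟪pleft n, k⟫ (t k).
    by have := H _ (leqnn _); rewrite pairK.
  elim: k => [_|k IHk kn].
    apply: (add _ _ d0); rewrite /justified !(pleftK, prightK).
    by constructor 3.
  have [s1 d1 f1] := IHk (ltnW kn); have [s2 d2 f2] := IHg _ _ (tS k kn).
  apply: (add _ _ (derivation_cat d1 d2)).
  rewrite /justified !(pleftK, prightK); constructor 3; split=> //=.
  by exists (t k); [exact: inl|exact: inr].
- move=> [/IHf[s0 d0 f0] fk].
  have [s1 d1 f1] : exists2 s, derivation s &
      forall i, i < v -> exists y, fact s (godel f) ⟪n, i⟫ y.+1.
    suff H w : w <= v -> exists2 s, derivation s &
      forall i, i < w -> exists y, fact s (godel f) ⟪n, i⟫ y.+1 by exact: H.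
    elim: w => [_|w IHw wv]; first by exists [::].
    have [s1 d1 f1] := IHw (ltnW wv); have [y /IHf[s2 d2 f2]] := fk _ wv.
    exists (s1 ++ s2); first exact: derivation_cat.
    move=> i; rewrite ltnS leq_eqVlt => /orP[/eqP ->|/f1[x f1x]].
      by exists y; exact: inr.
    by exists x; exact: inl.
  apply: (add _ _ (derivation_cat d0 d1)).
  rewrite /justified !(pleftK, prightK); constructor 4; split=> //.
    exact: inl.
  by move=> i /f1[y fy]; exists y; exact: inr.
Qed.

(** * A decidable form of derivations *)

Definition factb (t e n v : nat) : bool := fact (CodeSeq.decode t) e n v.

(** The existential quantifiers of [justified] are bounded by the code [t] of the list, which
    exceeds every value that a listed fact mentions. *)
Definition justifiedb (t z : nat) : bool :=
  let e := pleft z in let n := pleft (pright z) in let v := pright (pright z) in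
  let k := pleft e in let a := pright e in
  [|| (e == ⟪0, 0⟫) && (v == 0), (e == ⟪1, 0⟫) && (v == n.+1),
      (e == ⟪2, 0⟫) && (v == pleft n), (e == ⟪3, 0⟫) && (v == pright n),
      [&& k == 4, factb t (pleft a) n (pleft v) & factb t (pright a) n (pright v)],
      (k == 5) && has (fun y => factb t (pright a) n y && factb t (pleft a) y v)
                      (iota 0 t),
      (k == 6) && (if pright n == 0 then factb t (pleft a) (pleft n) v
        else has (fun y => factb t e ⟪pleft n, (pright n).-1⟫ y &&
          factb t (pright a) ⟪pleft n, ⟪(pright n).-1, y⟫⟫ v) (iota 0 t)) |
      [&& k == 7, factb t a ⟪n, v⟫ 0 &
          all (fun i => has (fun y => factb t a ⟪n, i⟫ y.+1) (iota 0 t)) (iota 0 v)]].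

Lemma factb_lt t e n v : factb t e n v -> v < t.
Proof.
move=> h; have /= := allP (CodeSeq.gtn_decode t) _ h.
have := pright_le ⟪e, ⟪n, v⟫⟫; have := pright_le ⟪n, v⟫.
by rewrite !prightK; lia.
Qed.

Lemma justifiedP t z : reflect (justified (CodeSeq.decode t) z) (justifiedb t z).
Proof.
have memI y i : y < i -> y \in iota 0 i by rewrite mem_iota.
apply: (iffP idP).
  case/orP=> [/andP[/eqP ? /eqP ?]|].
    by constructor 1; constructor 1.
  case/orP=> [/andP[/eqP ? /eqP ?]|].
    by constructor 1; constructor 2.
  case/orP=> [/andP[/eqP ? /eqP ?]|].
    by constructor 1; constructor 3.
  case/orP=> [/andP[/eqP ? /eqP ?]|].
    by constructor 1; constructor 4.
  case/orP=> [/and3P[/eqP ? ? ?]|].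
    by constructor 2; left.
  case/orP=> [/andP[/eqP ? /hasP[y _ /andP[? ?]]]|].
    by constructor 2; right; split=> //; exists y.
  case/orP=> [/andP[/eqP ? h]|].
    constructor 3; split=> //; case: ifPn h => // _ /hasP[y _ /andP[? ?]].
    by exists y.
  move=> /and3P[/eqP ? ? /allP h]; constructor 4; split=> // i iv.
  have /hasP[y _ ?] := h i (memI _ _ iv).
  by exists y.
rewrite /justifiedb; case.
- by case=> -[-> ->]; rewrite !eqxx ?orbT.
- case=> [[-> f g]|[-> [y f g]]].
    have -> : factb t (pleft (pright (pleft z))) (pleft (pright z))
      (pleft (pright (pright z))) by [].
    have -> : factb t (pright (pright (pleft z))) (pleft (pright z))
      (pright (pright (pright z))) by [].
    by rewrite !orbT.
  do 5 (apply/orP; right); apply/orP; left; rewrite eqxx /=.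
  by apply/hasP; exists y; [exact/memI/(factb_lt f)|rewrite /factb f g].
- move=> [-> h]; do 6 (apply/orP; right); apply/orP; left; rewrite eqxx /=.
  case: ifPn h => // _ [y f g].
  by apply/hasP; exists y; [exact/memI/(factb_lt f)|rewrite /factb f g].
- move=> [-> f h]; do 7 (apply/orP; right); apply/and3P; split=> //.
  apply/allP => i; rewrite mem_iota /= add0n => /h[y fy].
  apply/hasP; exists y => //; apply: memI.
  by have := factb_lt fy; lia.
Qed.

(** Kleene's T predicate, with a coded derivation in the role of the computation history. *)
Definition computes (t e n v : nat) : bool :=
  factb t e n v && all (justifiedb t) (CodeSeq.decode t).

Lemma computesP c n v : (exists t, computes t (godel c) n v) <-> denote c n v.
Proof.
split=> [[t /andP[ft /allP jt]]|/derivation_complete[s ds fs]].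
  by apply: derivation_sound ft => z /jt/justifiedP.
exists (CodeSeq.code s); rewrite /computes /factb CodeSeq.codeK; apply/andP; split=> //.
by apply/allP => z /ds; rewrite -{1}[s]CodeSeq.codeK => /justifiedP.
Qed.

Lemma recpred_factb (t e n v : nat -> nat) : recfun t -> recfun e -> recfun n -> recfun v ->
  recpred (fun x => factb (t x) (e x) (n x) (v x)).
Proof. by move=> ct ce cn cv; rewrite /factb /fact; rec_auto. Qed.

Lemma recpred_justifiedb (t z : nat -> nat) : recfun t -> recfun z ->
  recpred (fun x => justifiedb (t x) (z x)).
Proof.
move=> ct cz; apply: (@recfun2_app (fun t z => justifiedb t z)) => //.
by rewrite /recfun2 /justifiedb /factb /fact /=; rec_auto.
Qed.

Lemma recpred_computes (t e n v : nat -> nat) : recfun t -> recfun e -> recfun n -> recfun v ->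
  recpred (fun x => computes (t x) (e x) (n x) (v x)).
Proof.
move=> ct ce cn cv; rewrite /computes; apply: recpred_and; first exact: recpred_factb.
apply: recpred_all_decode => //; apply: recpred_justifiedb; last by rec_auto.
by apply: (recfun_comp ct); rec_auto.
Qed.

End Derivations.

Local Open Scope classical_set_scope.
Local Open Scope complex_scope.
Local Open Scope ring_scope.

(** * The modulus of a complex number *)

Section Modulus.
Variable R : realType.
Implicit Types x y : R[i].

(** The norm of [R[i]] takes values in [R[i]] itself; this is the real number behind it, for which
    suprema and linear arithmetic are available. *)
Definition modulus : R[i] -> R := @Normc.normc R.

Lemma normCE x : `|x| = (modulus x)%:C.
Proof. by []. Qed.

Lemma modulus_ge0 x : 0 <= modulus x.
Proof. by rewrite -ler0c -normCE. Qed.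

Lemma modulusE x : modulus x = Num.sqrt (complex.Re x ^+ 2 + complex.Im x ^+ 2).
Proof. by case: x. Qed.

Lemma modulus0 : modulus 0 = 0.
Proof. exact: Normc.normc0. Qed.

Lemma modulus1 : modulus 1 = 1.
Proof. exact: Normc.normc1. Qed.

Lemma modulus_eq0 x : modulus x = 0 -> x = 0.
Proof. exact: Normc.eq0_normc. Qed.

Lemma modulusM x y : modulus (x * y) = modulus x * modulus y.
Proof. exact: Normc.normcM. Qed.

Lemma modulusD x y : modulus (x + y) <= modulus x + modulus y.
Proof. exact: le_normcD. Qed.

Lemma modulusN x : modulus (- x) = modulus x.
Proof. exact: normcN. Qed.

Lemma modulusB x y z : modulus (x - z) <= modulus (x - y) + modulus (y - z).
Proof. by rewrite (le_trans _ (modulusD _ _))// addrA subrK. Qed.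

Lemma modulusC x y : modulus (x - y) = modulus (y - x).
Proof. by rewrite -modulusN opprB. Qed.

Lemma modulus_conj x : modulus (Num.conj x) = modulus x.
Proof. by case: x => a b; rewrite !modulusE /= sqrrN. Qed.

Lemma modulus_conjM x : modulus (Num.conj x * x) = modulus x ^+ 2.
Proof. by rewrite modulusM modulus_conj expr2. Qed.

Lemma modulus_leD x : modulus x <= `|complex.Re x| + `|complex.Im x|.
Proof.
rewrite modulusE -[leRHS]ger0_norm ?addr_ge0// -sqrtr_sqr ler_wsqrtr//.
by rewrite sqrrD !real_normK ?num_real// lerD2r lerDl mulrn_wge0.
Qed.

Lemma Re_le_modulus x : `|complex.Re x| <= modulus x.
Proof. by rewrite modulusE -sqrtr_sqr ler_wsqrtr// lerDl sqr_ge0. Qed.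

Lemma Im_le_modulus x : `|complex.Im x| <= modulus x.
Proof. by rewrite modulusE -sqrtr_sqr ler_wsqrtr// lerDr sqr_ge0. Qed.

End Modulus.

(** * Cauchy sequences of complex numbers *)

Definition cauchy_seq (R : realType) (f : nat -> R[i]) : Prop :=
  forall e : R, 0 < e ->
  exists N, forall n, (N <= n)%N -> modulus (f n - f N) < e.

Section Cauchy.
Variable R : realType.
Implicit Types f g : nat -> R[i].

Lemma cauchy_seq_bounded f : cauchy_seq f ->
  exists2 M, 0 < M & forall n, modulus (f n) <= M.
Proof.
move=> /(_ 1 ltr01)[N fN].
(* The sum bounds the finitely many terms before [N]; the later ones are within 1 of [f N]. *)
pose M := \sum_(k < N) modulus (f k) + modulus (f N) + 1.
have S0 : 0 <= \sum_(k < N) modulus (f k).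
  by apply: sumr_ge0 => k _; exact: modulus_ge0.
exists M => [|n]; first by have := modulus_ge0 (f N); rewrite /M; lra.
case: (ltnP n N) => nN.
  have : modulus (f n) <= \sum_(k < N) modulus (f k).
    rewrite (bigD1 (Ordinal nN))//= lerDl.
    by apply: sumr_ge0 => k _; exact: modulus_ge0.
  by have := modulus_ge0 (f N); rewrite /M; lra.
have := fN n nN; have := modulusD (f n - f N) (f N); rewrite subrK /M; lra.
Qed.

Lemma cauchy_seq_cauchy f e : cauchy_seq f -> 0 < e ->
  exists N, forall m n, (N <= m)%N -> (N <= n)%N -> modulus (f m - f n) < e.
Proof.
move=> cf e0; have [|N fN] := cf (e / 2); first by lra.
exists N => m n /fN fm /fN fn.
by have := modulusB (f m) (f N) (f n); rewrite (modulusC (f N)); lra.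
Qed.

Lemma cauchy_seq_cst c : cauchy_seq (fun=> c : R[i]).
Proof. by move=> e e0; exists 0%N => n _; rewrite subrr modulus0. Qed.

Lemma cauchy_seqD f g : cauchy_seq f -> cauchy_seq g ->
  cauchy_seq (fun n => f n + g n).
Proof.
move=> cf cg e e0; have e2 : 0 < e / 2 by lra.
have [M fM] := cauchy_seq_cauchy cf e2; have [N gN] := cauchy_seq_cauchy cg e2.
exists (maxn M N) => n; rewrite geq_max => /andP[Mn Nn].
have := fM _ _ Mn (leq_maxl M N); have := gN _ _ Nn (leq_maxr M N).
rewrite opprD addrACA => h1 h2; apply: le_lt_trans (modulusD _ _) _; lra.
Qed.

Lemma cauchy_seqM f g : cauchy_seq f -> cauchy_seq g ->
  cauchy_seq (fun n => f n * g n).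
Proof.
move=> cf cg e e0.
have [A A0 fA] := cauchy_seq_bounded cf; have [B B0 gB] := cauchy_seq_bounded cg.
(* Each of the two terms of the product estimate is to stay below [e / 2], hence the division by the
   bound of the other factor. *)
have [|M fM] := @cauchy_seq_cauchy _ (e / (2 * B)) cf; first by rewrite divr_gt0//; lra.
have [|N gN] := @cauchy_seq_cauchy _ (e / (2 * A)) cg; first by rewrite divr_gt0//; lra.
exists (maxn M N) => n; rewrite geq_max => /andP[Mn Nn].
have := fM _ _ Mn (leq_maxl M N); have := gN _ _ Nn (leq_maxr M N).
set k := maxn M N => h1 h2.
have -> : f n * g n - f k * g k = f n * (g n - g k) + (f n - f k) * g k.
  by rewrite mulrBr mulrBl addrA subrK.
apply: le_lt_trans (modulusD _ _) _; rewrite !modulusM.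
have : modulus (f n) * modulus (g n - g k) <= A * modulus (g n - g k).
  by rewrite ler_wpM2r ?modulus_ge0.
have : modulus (f n - f k) * modulus (g k) <= modulus (f n - f k) * B.
  by rewrite ler_wpM2l ?modulus_ge0.
have : A * modulus (g n - g k) < e / 2.
  rewrite mulrC -ltr_pdivlMr// (lt_le_trans h1)// -mulrA -invfM//.
have : modulus (f n - f k) * B < e / 2.
  by rewrite -ltr_pdivlMr// (lt_le_trans h2)// -mulrA -invfM.
lra.
Qed.

Lemma cauchy_seq_conj f : cauchy_seq f -> cauchy_seq (fun n => Num.conj (f n)).
Proof.
move=> cf e /cf[N fN]; exists N => n /fN.
by rewrite -rmorphB modulus_conj.
Qed.

Definition cseq_pred : {pred nat -> R[i]} := fun f => `[< cauchy_seq f >].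

Lemma cseq_predP f : reflect (cauchy_seq f) (f \in cseq_pred).
Proof. exact: asboolP. Qed.

Lemma cseq_submod_closed : submod_closed cseq_pred.
Proof.
split; first by apply/cseq_predP; exact: cauchy_seq_cst.
move=> a f g /cseq_predP cf /cseq_predP cg; apply/cseq_predP.
by apply: (cauchy_seqD _ cg); exact: (cauchy_seqM (cauchy_seq_cst a) cf).
Qed.

HB.instance Definition _ :=
  GRing.isSubmodClosed.Build R[i] (nat -> R[i]) cseq_pred cseq_submod_closed.

(** As the complex numbers are complete, these are the convergent sequences. The Cauchy condition
    spares carrying the limits along. *)
Record cseq : Type := CSeq {
  cseq_val :> nat -> R[i];
  cseqP : cseq_val \in cseq_pred }.

HB.instance Definition _ := [isSub for cseq_val].
HB.instance Definition _ := [Choice of cseq by <:].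
HB.instance Definition _ := [SubChoice_isSubLmodule of cseq by <:].

End Cauchy.

(** * Convergent sequences as a C*-algebra *)

Section SupNorm.
Variable R : realType.
Implicit Types f g h : cseq R.

Lemma cseq_cauchy f : cauchy_seq f.
Proof. by apply/cseq_predP; exact: cseqP. Qed.

Definition mk_cseq (f : nat -> R[i]) (cf : cauchy_seq f) : cseq R :=
  CSeq (introT (cseq_predP f) cf).

Lemma cseq_eq f g : f =1 g -> f = g.
Proof. by move=> fg; apply/val_inj/funext. Qed.

Lemma cseqD f g n : (f + g) n = f n + g n. Proof. by []. Qed.
Lemma cseqZ a f n : (a *: f) n = a * f n. Proof. by []. Qed.
Lemma cseqB f g n : (f - g) n = f n - g n. Proof. by []. Qed.

Definition sup_norm f : R := sup (range (fun n => modulus (f n))).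

Lemma has_sup_modulus f : has_sup (range (fun n => modulus (f n))).
Proof.
split; first by exists (modulus (f 0%N)), 0%N.
have [M _ fM] := cauchy_seq_bounded (@cseq_cauchy f).
by exists M => _ [n _ <-].
Qed.

Lemma modulus_le_norm f n : modulus (f n) <= sup_norm f.
Proof. by apply: ub_le_sup; [exact: (has_sup_modulus f).2|exists n]. Qed.

Lemma sup_norm_le f (M : R) : (forall n, modulus (f n) <= M) -> sup_norm f <= M.
Proof.
move=> fM; apply: ge_sup; first exact: (has_sup_modulus f).1.
by move=> _ [n _ <-].
Qed.

Lemma sup_norm_ge0 f : 0 <= sup_norm f.
Proof. exact: le_trans (modulus_ge0 _) (modulus_le_norm f 0). Qed.

Lemma sup_normD f g : sup_norm (f + g) <= sup_norm f + sup_norm g.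
Proof.
apply: sup_norm_le => n; rewrite cseqD.
apply: le_trans (modulusD _ _) _.
by have := modulus_le_norm f n; have := modulus_le_norm g n; lra.
Qed.

Lemma sup_norm_eq0 f : sup_norm f = 0 -> f = 0.
Proof.
move=> f0; apply: cseq_eq => n; apply: modulus_eq0.
by apply/eqP; rewrite eq_le modulus_ge0 andbT -f0 modulus_le_norm.
Qed.

(** One inequality holds termwise; the other is the same inequality for the scalar [a^-1] and the
    sequence [a *: f]. *)
Lemma sup_normZ a f : sup_norm (a *: f) = modulus a * sup_norm f.
Proof.
have le b g : sup_norm (b *: g) <= modulus b * sup_norm g.
  apply: sup_norm_le => n; rewrite cseqZ modulusM ler_wpM2l ?modulus_ge0//.
  exact: modulus_le_norm.
apply/eqP; rewrite eq_le le /=.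
have [->|a0] := eqVneq a 0; first by rewrite modulus0 mul0r sup_norm_ge0.
rewrite -[in leLHS](scalerK a0 f).
apply: le_trans (_ : modulus a * (modulus a^-1 * sup_norm (a *: f)) <= _).
  by rewrite ler_wpM2l ?modulus_ge0.
by rewrite mulrA -modulusM mulfV// modulus1 mul1r.
Qed.

Lemma sup_normCD f g :
  (sup_norm (f + g))%:C <= (sup_norm f)%:C + (sup_norm g)%:C.
Proof. by rewrite -rmorphD/= lecR sup_normD. Qed.

Lemma sup_normCZ (a : R[i]) f : (sup_norm (a *: f))%:C = `|a| * (sup_norm f)%:C.
Proof. by rewrite sup_normZ rmorphM. Qed.

Lemma sup_normC_eq0 f : (sup_norm f)%:C = 0 -> f = 0.
Proof. by move=> [] /sup_norm_eq0. Qed.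

HB.instance Definition _ := Lmodule_isNormed.Build R[i] (cseq R)
  sup_normCD sup_normCZ sup_normC_eq0.

Lemma cseq_normE f : `|f| = (sup_norm f)%:C.
Proof. by []. Qed.

Lemma cseq_ballP f g (e : R) : ball f e%:C g <-> sup_norm (f - g) < e.
Proof.
rewrite -ball_normE /= cseq_normE ltcR.
by split.
Qed.

(** At each index the real and imaginary parts converge along the filter. The pointwise limit stays
    uniformly close to suitable members of the algebra, which makes it Cauchy and the convergence
    uniform. *)
Lemma cseq_complete (F : set_system (cseq R)) :
  ProperFilter F -> cauchy F -> cvg F.
Proof.
move=> FF /cauchyP cF.
have {}cF e : 0 < e -> exists g, F [set f | sup_norm (g - f) < e].
  move=> e0; have [|g Fg] := cF e%:C; first by rewrite ltcR.
  by exists g; apply: filterS Fg => f /cseq_ballP.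
(* Stated for any 1-Lipschitz [re], so as to cover both real and imaginary parts. *)
have lim_ex (re : R[i] -> R) : (forall x y, `|re x - re y| <= modulus (x - y)) ->
    forall n, exists l : R, forall e : R, 0 < e -> F [set f : cseq R | `|re (f n) - l| < e].
  move=> re_le n.
  pose G : set_system R := fmap (fun f : cseq R => re (f n)) F.
  have PG : ProperFilter G by exact: fmap_proper_filter.
  have /(@R_complete R G PG) : cauchy G.
    apply/cauchyP => e e0.
    have [g Fg] := cF _ e0; exists (re (g n)).
    suff : F [set f : cseq R | ball (re (g n)) e (re (f n))] by [].
    apply: filterS Fg => f /= gf; rewrite -ball_normE /=.
    apply: le_lt_trans (re_le _ _) (le_lt_trans _ gf).
    exact: (modulus_le_norm (g - f)).
  move=> /cvg_ex[l /cvgrPdist_lt Gl]; exists l => e /Gl.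
  by rewrite /G near_simpl; apply: filterS => f /=; rewrite distrC.
have ReB : forall x y : R[i], `|complex.Re x - complex.Re y| <= modulus (x - y).
  by move=> [a b] [c d]; exact: Re_le_modulus ((a +i* b) - (c +i* d)).
have ImB : forall x y : R[i], `|complex.Im x - complex.Im y| <= modulus (x - y).
  by move=> [a b] [c d]; exact: Im_le_modulus ((a +i* b) - (c +i* d)).
have /choice[a aP] := lim_ex _ ReB.
have /choice[b bP] := lim_ex _ ImB.
pose l n := a n +i* b n.
(* Some [f] is close to both: [g] is within [e] of it in norm, and its real and imaginary parts at
   [n] are within [e] of those of [l n]. *)
have lP g e : 0 < e -> F [set f | sup_norm (g - f) < e] ->
    forall n, modulus (g n - l n) < 3 * e.
  move=> e0 Fg n.
  have /filter_ex[f [[/= gf af] bf]] :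
      F ([set f | sup_norm (g - f) < e] `&` [set f : cseq R | `|complex.Re (f n) - a n| < e]
         `&` [set f : cseq R | `|complex.Im (f n) - b n| < e]).
    by apply: filterI; [apply: filterI => //; exact: aP|exact: bP].
  apply: le_lt_trans (modulusB _ (f n) _) _.
  have := le_lt_trans (modulus_le_norm (g - f) n) gf.
  have : modulus (f n - l n) < 2 * e.
    apply: le_lt_trans (modulus_leD _) _.
    by move: af bf; rewrite /l; case: (f n) => x y /=; lra.
  by rewrite cseqB; lra.
have cl : cauchy_seq l.
  (* The passages from [l] to [g] and back cost [e / 3] each, the variation of [g] costs [e / 9]. *)
  move=> e e0; have e9 : 0 < e / 9 by lra.
  have [g /(lP _ _ e9) gl] := cF _ e9.
  have [N gN] := cseq_cauchy g e9.
  exists N => n /gN gn.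
  have := gl n; have := gl N.
  have := modulusB (l n) (g n) (l N); have := modulusB (g n) (g N) (l N).
  by rewrite (modulusC (l n) (g n)); lra.
apply/cvg_ex; exists (mk_cseq cl).
apply/cvgrPdist_le => e e0.
(* A positive element of [R[i]] has imaginary part 0. *)
have [r r0 eE] : exists2 r : R, 0 < r & e = r%:C.
  move: e0; case: e => x y; rewrite ltcE /= => /andP[/eqP -> x0].
  by exists x.
rewrite eE.
have r4 : 0 < r / 4 by lra.
have [g Fg] := cF _ r4.
have gl := lP _ _ r4 Fg.
apply: filterS Fg => f /= gf; rewrite cseq_normE lecR.
apply: sup_norm_le => n; rewrite cseqB /=.
have := modulusB (l n) (g n) (f n); rewrite (modulusC (l n) (g n)).
have := le_lt_trans (modulus_le_norm (g - f) n) gf; rewrite cseqB.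
by have := gl n; lra.
Qed.

HB.instance Definition _ := Uniform_isComplete.Build (cseq R) cseq_complete.

Definition cseq_mul f g : cseq R :=
  mk_cseq (cauchy_seqM (@cseq_cauchy f) (@cseq_cauchy g)).

Definition cseq_star f : cseq R := mk_cseq (cauchy_seq_conj (@cseq_cauchy f)).

Lemma cseq_mulA : associative cseq_mul.
Proof. by move=> f g h; apply: cseq_eq => n; exact: mulrA. Qed.

Lemma cseq_mulDl : left_distributive cseq_mul +%R.
Proof. by move=> f g h; apply: cseq_eq => n; exact: mulrDl. Qed.

Lemma cseq_mulDr : right_distributive cseq_mul +%R.
Proof. by move=> f g h; apply: cseq_eq => n; exact: mulrDr. Qed.

Lemma cseq_scaleAl (a : R[i]) f g : a *: cseq_mul f g = cseq_mul (a *: f) g.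
Proof. by apply: cseq_eq => n; exact: mulrA. Qed.

Lemma cseq_scaleAr (a : R[i]) f g : a *: cseq_mul f g = cseq_mul f (a *: g).
Proof. by apply: cseq_eq => n; exact: mulrCA. Qed.

Lemma cseq_starK : involutive cseq_star.
Proof. by move=> f; apply: cseq_eq => n; exact: conjCK. Qed.

Lemma cseq_starD f g : cseq_star (f + g) = cseq_star f + cseq_star g.
Proof. by apply: cseq_eq => n; exact: rmorphD. Qed.

Lemma cseq_starZ (a : R[i]) f : cseq_star (a *: f) = Num.conj a *: cseq_star f.
Proof. by apply: cseq_eq => n; exact: rmorphM. Qed.

Lemma cseq_starM f g :
  cseq_star (cseq_mul f g) = cseq_mul (cseq_star g) (cseq_star f).
Proof. by apply: cseq_eq => n; rewrite /= rmorphM mulrC. Qed.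

Lemma cseq_normM f g : `|cseq_mul f g| <= `|f| * `|g|.
Proof.
rewrite !cseq_normE -rmorphM/= lecR; apply: sup_norm_le => n /=.
by rewrite modulusM ler_pM ?modulus_ge0 ?modulus_le_norm.
Qed.

(** The supremum of the squared moduli is the square of the supremum; for the lower bound one passes
    to square roots termwise. *)
Lemma cseq_norm_starM f : `|cseq_mul (cseq_star f) f| = `|f| ^+ 2.
Proof.
rewrite !cseq_normE -rmorphXn/=; congr (_%:C).
apply/eqP; rewrite eq_le; apply/andP; split.
  apply: sup_norm_le => n /=; rewrite modulus_conjM.
  by rewrite lerXn2r ?nnegrE ?modulus_ge0 ?sup_norm_ge0 ?modulus_le_norm.
rewrite -[leRHS]sqr_sqrtr ?sup_norm_ge0// lerXn2r ?nnegrE ?sqrtr_ge0 ?sup_norm_ge0//.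
apply: sup_norm_le => n.
rewrite -[leLHS]ger0_norm ?modulus_ge0// -sqrtr_sqr ler_wsqrtr//.
by rewrite -modulus_conjM; exact: (modulus_le_norm (cseq_mul (cseq_star f) f)).
Qed.

HB.instance Definition _ :=
  CompleteNormedModule_isCStarAlgebra.Build R (cseq R)
    cseq_mulA cseq_mulDl cseq_mulDr cseq_scaleAl cseq_scaleAr
    cseq_starK cseq_starD cseq_starZ cseq_starM cseq_normM cseq_norm_starM.

Definition cseq_one : cseq R := mk_cseq (cauchy_seq_cst (1 : R[i])).

Lemma cseq_unit : is_cunit cseq_one.
Proof.
by move=> f; split; apply: cseq_eq => n; [exact: mul1r|exact: mulr1].
Qed.

Lemma cseq_cmulC : commutative (@cmul R (cseq R)).
Proof. by move=> f g; apply: cseq_eq => n; exact: mulrC. Qed.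

End SupNorm.

(** * Presentations by an exceptional index *)

(** The generators take only the values 0 and 1. Kept as booleans, they make stars trivial and turn
    words into conjunctions. *)
Definition genb (E : pred nat) (k n : nat) : bool :=
  if k is k'.+1 then k' == n else ~~ E n.

Definition wordb (E : pred nat) (w : word) (n : nat) : bool :=
  all (fun l : letter => genb E l.1 n) (w.1 :: w.2).

(** The value at index [n], computed exactly in the Gaussian rationals. *)
Definition polyval (E : pred nat) (n : nat) (p : starpoly) : complex rat :=
  \sum_(m <- p) if wordb E m.2 n then m.1 else 0.

Definition abs2 (z : complex rat) : rat := complex.Re z ^+ 2 + complex.Im z ^+ 2.

Lemma abs2_ge0 z : 0 <= abs2 z.
Proof. by rewrite addr_ge0// sqr_ge0. Qed.

(** Members of a coded list are smaller than its code, and neither projections nor halving increase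
    a number. *)
Lemma letter_lt j m l : m \in starpoly_enum j -> l \in m.2.1 :: m.2.2 ->
  (l.1 < j)%N.
Proof.
move=> /mapP[z zj ->]; have /= zltj := allP (CodeSeq.gtn_decode j) _ zj.
have le : (pright z <= z)%N := pright_le z.
rewrite inE => /orP[/eqP ->|/mapP[a ax ->]] /=.
  by have := pleft_le (pright z); lia.
have := allP (CodeSeq.gtn_decode _) _ ax; have := pright_le (pright z).
by rewrite /=; lia.
Qed.

Lemma wordb_eq E m n j w : w \in starpoly_enum j -> (j <= m)%N -> (j <= n)%N ->
  E m = E n -> wordb E w.2 m = wordb E w.2 n.
Proof.
move=> wj jm jn Emn; apply: eq_in_all => l lw.
have := letter_lt wj lw; case: l.1 => [|k] kj /=; first by rewrite Emn.
by lia.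
Qed.

Lemma polyval_tail E m n j : (j <= m)%N -> (j <= n)%N -> E m = E n ->
  polyval E m (starpoly_enum j) = polyval E n (starpoly_enum j).
Proof.
move=> jm jn Emn; apply: eq_big_seq => w wj.
by rewrite (wordb_eq wj jm jn Emn).
Qed.

(** Words are nonempty, and the first letter of each already vanishes at [n]: [u_0] because [n] is
    exceptional, [delta_k] because [k < n]. *)
Lemma polyval_exceptional (E : pred nat) n j : (j <= n)%N -> E n ->
  polyval E n (starpoly_enum j) = 0.
Proof.
move=> jn En; apply: big1_seq => w /andP[_ wj]; rewrite ifF//.
rewrite /wordb /=; have := letter_lt wj (mem_head _ _).
by case: w.2.1.1 => [|k] kj /=; [rewrite En|apply/negbTE; lia].
Qed.

Definition atmost1 (E : pred nat) : Prop := forall m n, E m -> E n -> m = n.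

(** Of [j] and [j + 1] at most one is exceptional, so the other one represents all ordinary indices
    from [j] on; this is why [j + 2] indices suffice. *)
Lemma polyval_dominated E j n : atmost1 E ->
  exists2 k, (k < j.+2)%N &
    abs2 (polyval E n (starpoly_enum j)) <= abs2 (polyval E k (starpoly_enum j)).
Proof.
move=> E1; case: (ltnP n j.+2) => nj; first by exists n.
case: (boolP (E n)) => En.
  exists 0%N => //; rewrite polyval_exceptional//; last by lia.
  by rewrite [leLHS]/abs2 expr0n addr0 abs2_ge0.
have [k [jk kj Ek]] : exists k, [/\ j <= k, k < j.+2 & ~~ E k]%N.
  case: (boolP (E j)) => Ej; last by exists j.
  exists j.+1; split=> //; apply/negP => Ej1.
  by have := E1 _ _ Ej Ej1; lia.
exists k => //; rewrite (@polyval_tail E n k)//; first by lia.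
by rewrite (negbTE En) (negbTE Ek).
Qed.

Section Presentation.
Variable R : realType.
Variables (E : pred nat) (E1 : atmost1 E).

Lemma gen_cauchy k : cauchy_seq (fun n => (genb E k n)%:R : R[i]).
Proof.
move=> e e0.
have [N EN] : exists N, forall n, (N <= n)%N -> genb E k n = genb E k N.
  case: k => [|k] /=; last by exists k.+1 => n; lia.
  have [[m Em]|nE] := pselect (exists m, E m).
    exists m.+1 => n mn.
    have nE i : (m < i)%N -> E i = false.
      by move=> mi; apply/negP => Ei; have := E1 Em Ei; lia.
    by rewrite !nE.
  have nE' i : E i = false by apply/negP => Ei; apply: nE; exists i.
  by exists 0%N => n _; rewrite !nE'.
by exists N => n /EN ->; rewrite subrr modulus0.
Qed.

Definition gen k : cseq R := mk_cseq (gen_cauchy k).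

Notation qi := (@qi_embed R).

Lemma qiD z w : qi (z + w) = qi z + qi w.
Proof. by case: z w => a b [c d]; rewrite /qi_embed /= !rmorphD. Qed.

Lemma qi0 : qi 0 = 0.
Proof. by rewrite /qi_embed /= !rmorph0. Qed.

Lemma letter_evalE l n : letter_eval gen l n = (genb E l.1 n)%:R.
Proof. by rewrite /letter_eval; case: l.2 => //=; rewrite rmorph_nat. Qed.

Lemma word_evalE w n : word_eval gen w n = (wordb E w n)%:R.
Proof.
rewrite /word_eval /wordb /=.
have : letter_eval gen w.1 n = (genb E w.1.1 n)%:R by exact: letter_evalE.
elim: w.2 (letter_eval gen w.1) (genb E w.1.1 n) => [|l s IHs] f b fb /=.
  by rewrite andbT.
rewrite (IHs _ (b && genb E l.1 n)) ?andbA//.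
have -> : cmul f (letter_eval gen l) n = f n * letter_eval gen l n by [].
by rewrite fb letter_evalE -natrM mulnb.
Qed.

Lemma starpoly_evalE p n : starpoly_eval gen p n = qi (polyval E n p).
Proof.
rewrite /starpoly_eval /polyval; elim: p => [|m p IHp].
  by rewrite !big_nil qi0.
rewrite !big_cons cseqD IHp qiD cseqZ word_evalE.
by case: wordb; rewrite ?mulr1// mulr0 qi0.
Qed.

Lemma modulus_qi z : modulus (qi z) = Num.sqrt (ratr (abs2 z)).
Proof. by rewrite modulusE /abs2 rmorphD !rmorphXn. Qed.

Lemma lt_modulus_qi r z : 0 < r -> (ratr r < modulus (qi z)) = (r ^+ 2 < abs2 z).
Proof.
move=> r0; rewrite modulus_qi.
have <- : Num.sqrt (ratr (r ^+ 2) : R) = ratr r.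
  by rewrite rmorphXn sqrtr_sqr ger0_norm// ler0q ltW.
by rewrite ltNge ler_sqrt ?ler0q ?sqr_ge0// ler_rat -ltNge.
Qed.

Lemma modulus_qi_lt r z : 0 < r -> (modulus (qi z) < ratr r) = (abs2 z < r ^+ 2).
Proof.
move=> r0; rewrite modulus_qi.
have <- : Num.sqrt (ratr (r ^+ 2) : R) = ratr r.
  by rewrite rmorphXn sqrtr_sqr ger0_norm// ler0q ltW.
by rewrite ltNge ler_sqrt ?ler0q ?abs2_ge0// ler_rat -ltNge.
Qed.

Lemma modulus_qi_le z w : abs2 z <= abs2 w -> modulus (qi z) <= modulus (qi w).
Proof. by move=> zw; rewrite !modulus_qi ler_wsqrtr// ler_rat. Qed.

Lemma sup_norm_attained j :
  exists2 k, (k < j.+2)%N &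
    sup_norm (rational_vector gen j) = modulus (qi (polyval E k (starpoly_enum j))).
Proof.
pose v k := modulus (qi (polyval E k (starpoly_enum j))).
have [k _ kmax] : exists2 k : 'I_j.+2, true & forall i : 'I_j.+2, v i <= v k.
  have := @arg_maxP _ _ _ ord0 xpredT (fun i : 'I_j.+2 => v i) isT.
  by case=> k _ kP; exists k => // i; exact: kP.
exists k => //; apply/eqP; rewrite eq_le; apply/andP; split.
  apply: sup_norm_le => n; rewrite /rational_vector starpoly_evalE.
  have [i ij /modulus_qi_le le] := polyval_dominated j n E1.
  exact: le_trans le (kmax (Ordinal ij)).
by rewrite -starpoly_evalE; exact: modulus_le_norm.
Qed.

Lemma ratrC (r : rat) : ratr r = (ratr r : R)%:C.
Proof. by rewrite fmorph_rat. Qed.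

(** With [norm_ltP], this reduces the diagram to finitely many comparisons of rational numbers;
    squaring removes the root. *)
Lemma lt_normP r j : 0 < r ->
  ratr r < `|rational_vector gen j| <->
  exists2 k, (k < j.+2)%N & r ^+ 2 < abs2 (polyval E k (starpoly_enum j)).
Proof.
move=> r0; rewrite cseq_normE ratrC ltcR; split.
  have [k kj ->] := sup_norm_attained j.
  by rewrite lt_modulus_qi//; exists k.
move=> [k kj rk]; apply: lt_le_trans (modulus_le_norm _ k).
by rewrite /rational_vector starpoly_evalE lt_modulus_qi.
Qed.

Lemma norm_ltP r j : 0 < r ->
  `|rational_vector gen j| < ratr r <->
  forall k, (k < j.+2)%N -> abs2 (polyval E k (starpoly_enum j)) < r ^+ 2.
Proof.
move=> r0; rewrite cseq_normE ratrC ltcR; split.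
  move=> lt k kj; rewrite -modulus_qi_lt//.
  by apply: le_lt_trans lt; rewrite -starpoly_evalE; exact: modulus_le_norm.
have [k kj ->] := sup_norm_attained j.
by move=> /(_ k kj); rewrite modulus_qi_lt.
Qed.

Lemma qi_dense (z : R[i]) (e : R) : 0 < e -> exists q, modulus (z - qi q) < e.
Proof.
case: z => a b e0.
have near (x : R) : exists q : rat, `|x - ratr q| < e / 2.
  have [|q] := @rat_in_itvoo R (x - e / 2) (x + e / 2); first by lra.
  rewrite in_itv /= => /andP[h1 h2]; exists q; rewrite ltr_norml; lra.
have [p ap] := near a; have [q bq] := near b.
exists (p +i* q); apply: le_lt_trans (modulus_leD _) _ => /=; lra.
Qed.

Lemma polyval_cat n p q : polyval E n (p ++ q) = polyval E n p + polyval E n q.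
Proof. by rewrite /polyval big_cat. Qed.

(** A convergent sequence is uniformly close to an eventually constant one with values in the
    Gaussian rationals, and such a sequence is a linear combination of [u_0] and finitely many
    [delta_k]. *)
Lemma gen_dense : dense (range (rational_vector gen)).
Proof.
move=> O [f Of] openO.
have /nbhs_ballP[eps eps0 epsO] : nbhs f O by exact: open_nbhs_nbhs.
have [e e0 epsE] : exists2 e : R, 0 < e & eps = e%:C.
  move: eps0; case: (eps) => x y /=; rewrite ltcE /= => /andP[/eqP -> x0].
  by exists x.
have e4 : 0 < e / 4 by lra.
have [N0 fN0] := cauchy_seq_cauchy (cseq_cauchy f) e4.
(* Beyond the exceptional index [u_0] equals 1, so [c N *: u_0] produces the constant tail. *)
have [N EN] : exists N, (N0 <= N)%N /\ forall n, (N <= n)%N -> ~~ E n.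
  have [[m Em]|nE] := pselect (exists m, E m).
    exists (maxn N0 m.+1); split=> [|n]; first exact: leq_maxl.
    rewrite geq_max => /andP[_ mn]; apply/negP => En.
    by have := E1 Em En; lia.
  by exists N0; split=> // n _; apply/negP => En; apply: nE; exists n.
have /choice[c cP] : forall n, exists q, modulus (f n - qi q) < e / 4.
  by move=> n; exact: qi_dense.
(* The coefficient of [delta_k] corrects the contribution of [c N *: u_0], which is 0 at the
   exceptional index. *)
pose d k := c k - (if E k then 0 else c N).
pose p : starpoly := (c N, ((0%N, false), [::])) ::
  [seq (d k, ((k.+1, false), [::])) | k <- iota 0 N].
have pE n : polyval E n p = if (n < N)%N then c n else c N.
  have dE M : polyval E n [seq (d k, ((k.+1, false), [::])) | k <- iota 0 M]
      = if (n < M)%N then d n else 0.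
    elim: M => [|M IHM]; first by rewrite /polyval big_nil.
    rewrite -[M.+1]addn1 iotaD map_cat polyval_cat IHM /polyval /= big_seq1 /=.
    rewrite /wordb /= andbT add0n.
    have [->|nM] := eqVneq M n; first by rewrite ltnn addn1 leqnn add0r.
    by rewrite addr0; congr (if _ then _ else _); lia.
  rewrite /p -cat1s polyval_cat dE /polyval big_seq1 /wordb /= andbT.
  case: (ltnP n N) => nN; first by rewrite /d; case: (E n) => /=; rewrite ?subr0 ?add0r// addrC subrK.
  by rewrite (EN.2 n nN) addr0.
have [j jp] := starpoly_enum_surj p.
exists (rational_vector gen j); split; last by exists j.
apply: epsO; rewrite epsE; apply/cseq_ballP.
apply: le_lt_trans (_ : e / 2 < _); last by lra.
apply: sup_norm_le => n; rewrite cseqB /rational_vector jp starpoly_evalE pE.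
case: ifPn => nN; first by have := cP n; lra.
rewrite -leqNgt in nN; have := cP N.
have := fN0 n N (leq_trans EN.1 nN) EN.1.
by have := modulusB (f n) (f N) (qi (c N)); lra.
Qed.

Definition pres : presentation (cseq R) := Presentation gen_dense.

(** At [n] the rational vector is 0 and the unit is 1. *)
Lemma polyval_exceptional_far j n : (j <= n)%N -> E n ->
  `|rational_vector pres j - cseq_one R| < (2 ^- 1 : R[i]) -> False.
Proof.
move=> jn En; rewrite cseq_normE.
have -> : (2 ^- 1 : R[i]) = (2^-1 : R)%:C by rewrite expr1 rmorphV ?unitfE//= rmorph_nat.
rewrite ltcR => lt.
have := le_lt_trans (modulus_le_norm _ n) lt.
rewrite cseqB /rational_vector starpoly_evalE polyval_exceptional// qi0 sub0r.
by rewrite modulusN modulus1; lra.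
Qed.

End Presentation.

(** * Deciding the diagram *)

(** A rational is coded as [⟪a, ⟪b, d⟫⟫], meaning [(a - b) / d]; this avoids signs. *)
Definition fracval (s : nat) : rat :=
  ((pleft s)%:R - (pleft (pright s))%:R) / (pright (pright s))%:R.

(** Adds [rat_enum c] without reducing the fraction. In [int_enum] an even code [2 b] stands for [b]
    and an odd code [2 b + 1] for [- (b + 1)]. *)
Definition fracadd (s c : nat) : nat :=
  let d := pright (pright s) in let e := (pright c).+1 in
  let b := (pleft c)./2 in
  ⟪pleft s * e + (if odd (pleft c) then 0 else b) * d,
   ⟪pleft (pright s) * e + (if odd (pleft c) then b.+1 else 0) * d, d * e⟫⟫%N.

Lemma fracaddP s c : (0 < pright (pright s))%N ->
  (0 < pright (pright (fracadd s c)))%N /\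
  fracval (fracadd s c) = fracval s + rat_enum c.
Proof.
rewrite /fracadd /fracval /rat_enum /int_enum => d0.
rewrite !(pleftK, prightK); split; first by rewrite muln_gt0 d0.
have d0' : (pright (pright s))%:R != 0 :> rat by rewrite pnatr_eq0 -lt0n.
have e0 : (pright c).+1%:R != 0 :> rat by rewrite pnatr_eq0.
have -> : (if odd (pleft c) then Negz (pleft c)./2 else Posz (pleft c)./2)%:~R
   = (if odd (pleft c) then 0 else (pleft c)./2)%:R
     - (if odd (pleft c) then (pleft c)./2.+1 else 0)%:R :> rat.
  by case: odd; rewrite ?sub0r ?subr0 // NegzE mulrNz.
rewrite !natrD !natrM; field.
by apply/andP.
Qed.

(** At least one of the two truncated subtractions is 0. *)
Definition fracabs (s : nat) : nat :=
  ((pleft s - pleft (pright s)) + (pleft (pright s) - pleft s))%N.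

Lemma fracval_sqr s : (fracval s) ^+ 2 = ((fracabs s)%:R / (pright (pright s))%:R) ^+ 2.
Proof.
rewrite /fracval /fracabs !expr_div_n; congr (_ / _).
have [h|h] := leqP (pleft s) (pleft (pright s)).
  have -> : (pleft s - pleft (pright s) = 0)%N by lia.
  by rewrite add0n natrB// -sqrrN opprB.
have -> : (pleft (pright s) - pleft s = 0)%N by lia.
by rewrite addn0 natrB// ltnW.
Qed.

Section Decision.
(** [T x] is the exceptional set for the parameter [x], which remains an argument of every program
    below. *)
Variable T : nat -> nat -> bool.
Hypothesis recT : recfun2 (fun x n => T x n).

Definition letterc (x n l : nat) : bool :=
  if l./2 == 0%N then ~~ T x n else (l./2).-1 == n.

Lemma lettercE x n l : letterc x n l = genb (T x) (letter_enum l).1 n.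
Proof. by rewrite /letterc /letter_enum /=; case: (l./2). Qed.

Definition wordc (x n w : nat) : bool :=
  letterc x n (pleft w) && all (letterc x n) (CodeSeq.decode (pright w)).

Lemma wordcE x n w : wordc x n w = wordb (T x) (word_enum w) n.
Proof.
rewrite /wordc /wordb /= all_map lettercE; congr andb.
by apply: eq_all => l; rewrite /= lettercE.
Qed.

(** Here [y] is [⟪x, n⟫], [s] holds the fractions for the real and imaginary parts of the partial
    sum, and [m] codes a monomial. *)
Definition polystep (y s m : nat) : nat :=
  if wordc (pleft y) (pright y) (pright m) then
    ⟪fracadd (pleft s) (pleft (pleft m)), fracadd (pright s) (pright (pleft m))⟫
  else s.

Definition polyc (x n j : nat) : nat :=
  foldl (polystep ⟪x, n⟫) ⟪⟪0, ⟪0, 1⟫⟫, ⟪0, ⟪0, 1⟫⟫⟫%N (CodeSeq.decode j).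

Definition denre (s : nat) := pright (pright (pleft s)).
Definition denim (s : nat) := pright (pright (pright s)).

Lemma polycP x n j : [/\ (0 < denre (polyc x n j))%N, (0 < denim (polyc x n j))%N &
  polyval (T x) n (starpoly_enum j) =
    Complex (fracval (pleft (polyc x n j))) (fracval (pright (polyc x n j)))].
Proof.
(* The initial accumulator, zero with denominators 1, is generalized to any one with positive
   denominators. *)
rewrite /polyc /starpoly_enum; set s := (X in foldl _ X _).
have [s1 s2] : (0 < denre s)%N /\ (0 < denim s)%N.
  by rewrite /denre /denim /s !(pleftK, prightK).
have -> : polyval (T x) n (map monomial_enum (CodeSeq.decode j)) =
    Complex (fracval (pleft s)) (fracval (pright s)) +
    polyval (T x) n (map monomial_enum (CodeSeq.decode j)).
  by rewrite /s /fracval !(pleftK, prightK) subr0 mul0r -[Complex 0 0]/(0 : complex rat) add0r.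
move: s s1 s2; elim: (CodeSeq.decode j) => [|m t IHt] s s1 s2 /=.
  split=> //; rewrite /polyval big_nil. by rewrite addr0.
have [] := IHt (polystep ⟪x, n⟫ s m).
- by rewrite /polystep; case: ifP => // _; rewrite /denre pleftK (fracaddP _ s1).1.
- by rewrite /polystep; case: ifP => // _; rewrite /denim prightK (fracaddP _ s2).1.
move=> h1 h2 <-; split=> //; rewrite /polyval big_cons addrA; congr (_ + _).
rewrite /polystep pleftK prightK wordcE; case: ifP => _; last by rewrite addr0.
by rewrite !(pleftK, prightK) (fracaddP _ s1).2 (fracaddP _ s2).2.
Qed.

(** The numerator of the squared modulus over the common denominator [abs2den]. *)
Definition abs2num (s : nat) : nat :=
  ((fracabs (pleft s) * denim s) * (fracabs (pleft s) * denim s)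
   + (fracabs (pright s) * denre s) * (fracabs (pright s) * denre s))%N.

Definition abs2den (s : nat) : nat := ((denre s * denim s) * (denre s * denim s))%N.

Lemma abs2_polyval x n j : abs2 (polyval (T x) n (starpoly_enum j)) =
  (abs2num (polyc x n j))%:R / (abs2den (polyc x n j))%:R.
Proof.
have [d1 d2 ->] := polycP x n j; rewrite /abs2 /= !fracval_sqr.
rewrite -/(denre _) -/(denim _) /abs2num /abs2den !(natrD, natrM).
have d10 : (denre (polyc x n j))%:R != 0 :> rat by rewrite pnatr_eq0 -lt0n.
have d20 : (denim (polyc x n j))%:R != 0 :> rat by rewrite pnatr_eq0 -lt0n.
by field; apply/andP.
Qed.

Lemma abs2den_gt0 x n j : (0 < abs2den (polyc x n j))%N.
Proof. by have [d1 d2 _] := polycP x n j; rewrite /abs2den !muln_gt0 d1 d2. Qed.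

Definition ratval (r : nat) : rat := (pleft r)%:R / (pright r)%:R.

Definition rat_lt_abs (r s : nat) : bool :=
  (pleft r * pleft r * abs2den s < pright r * pright r * abs2num s)%N.

Definition abs_lt_rat (r s : nat) : bool :=
  (pright r * pright r * abs2num s < pleft r * pleft r * abs2den s)%N.

Lemma rat_lt_absP r x n j : (0 < pright r)%N -> rat_lt_abs r (polyc x n j) =
  (ratval r ^+ 2 < abs2 (polyval (T x) n (starpoly_enum j))).
Proof.
move=> r0; rewrite abs2_polyval /ratval expr_div_n.
rewrite ltr_pdivrMr ?exprn_gt0 ?ltr0n// mulrAC ltr_pdivlMr ?ltr0n ?abs2den_gt0//.
by rewrite -!natrX -!natrM ltr_nat [X in (_ < X)%N]mulnC -!mulnn.
Qed.

Lemma abs_lt_ratP r x n j : (0 < pright r)%N -> abs_lt_rat r (polyc x n j) =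
  (abs2 (polyval (T x) n (starpoly_enum j)) < ratval r ^+ 2).
Proof.
move=> r0; rewrite abs2_polyval /ratval expr_div_n.
rewrite ltr_pdivlMr ?exprn_gt0 ?ltr0n// mulrAC ltr_pdivrMr ?ltr0n ?abs2den_gt0//.
by rewrite -!natrX -!natrM ltr_nat [X in (X < _)%N]mulnC -!mulnn.
Qed.

Definition dvdc (k a : nat) : bool := has (fun q => q * k == a)%N (iota 0 a.+1).

Lemma dvdcE k a : (0 < a)%N -> dvdc k a = (k %| a)%N.
Proof.
move=> a0; apply/hasP/idP => [[q _ /eqP <-]|/dvdnP[q aE]]; first exact: dvdn_mull.
exists q; rewrite ?aE// mem_iota /= add0n ltnS.
by case: k aE => [|k] aE; nia.
Qed.

(** Since [rat_code] uses lowest terms, the codes of positive rationals are the pairs of positive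
    coprime numbers. *)
Definition valid_rat (r : nat) : bool :=
  [&& 0 < pleft r, 0 < pright r &
    all (fun k => dvdc k (pleft r) && dvdc k (pright r) ==> (k == 1))
      (iota 0 (pleft r).+1)]%N.

Lemma valid_ratP r : reflect (exists2 q : rat, 0 < q & rat_code q = r) (valid_rat r).
Proof.
apply: (iffP and3P) => [[a0 b0 /allP h]|[q q0 <-]].
  have cop : coprime (pleft r) (pright r).
    have g0 : (0 < gcdn (pleft r) (pright r))%N by rewrite gcdn_gt0 a0.
    (* Coprimality follows by testing the common divisor [gcdn] itself. *)
    have := h (gcdn (pleft r) (pright r)).
    rewrite mem_iota /= add0n ltnS dvdn_leq ?dvdn_gcdl// => /(_ isT).
    by rewrite !dvdcE// dvdn_gcdl dvdn_gcdr.
  exists (ratval r); first by rewrite divr_gt0// ltr0n.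
  rewrite /rat_code /ratval -[(pleft r)%:R]/((Posz (pleft r))%:~R) -[(pright r)%:R]/((Posz (pright r))%:~R).
  rewrite coprimeq_num// coprimeq_den//=.
  by rewrite gtr0_sg ?ltz_nat// mul1r gt_eqF ?ltz_nat//= pairK.
rewrite /rat_code !(pleftK, prightK).
have n0 : (0 < absz (numq q))%N by rewrite absz_gt0 numq_eq0 gt_eqF.
have d0 : (0 < absz (denq q))%N by rewrite absz_gt0 denq_neq0.
split=> //; apply/allP => k _; rewrite !dvdcE//.
apply/implyP => /andP[k1 k2].
have /eqP g1 := coprime_num_den q.
by rewrite -dvdn1 -g1 dvdn_gcd k1.
Qed.

Lemma ratval_code q : 0 < q -> ratval (rat_code q) = q.
Proof.
move=> q0; rewrite /ratval /rat_code pleftK prightK.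
rewrite -[in RHS](divq_num_den q); congr (_ / _).
  by rewrite -[in RHS](gtz0_abs (_ : 0 < numq q)) ?numq_gt0.
by rewrite -[in RHS](gtz0_abs (denq_gt0 q)).
Qed.

Definition diagc (x z : nat) : bool :=
  let r := pleft z in let j := pleft (pright z) in let r' := pright (pright z) in
  [&& valid_rat r, valid_rat r',
      has (fun k => rat_lt_abs r (polyc x k j)) (iota 0 j.+2) &
      all (fun k => abs_lt_rat r' (polyc x k j)) (iota 0 j.+2)].

Lemma diagcP (R : realType) x (Tx : atmost1 (T x)) z :
  diagc x z <-> exists2 t, diagram (pres R Tx) t & triple_code t = z.
Proof.
have valid_gt0 r : valid_rat r -> (0 < pright r)%N by case/and3P.
split.
  case/and4P => v1 v2 /hasP[k kj lt1] /allP lt2.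
  have [q q0 qE] := valid_ratP _ v1; have [q' q'0 q'E] := valid_ratP _ v2.
  exists (q, pleft (pright z), q'); last by rewrite /= qE q'E !pairK.
  split=> //.
    apply/lt_normP => //; exists k; first by move: kj; rewrite mem_iota.
    by rewrite -(ratval_code q0) qE -rat_lt_absP// valid_gt0.
  apply/norm_ltP => // i ij.
  by rewrite -(ratval_code q'0) q'E -abs_lt_ratP ?valid_gt0// lt2// mem_iota.
move=> [[[q j] q'] [q0 q'0 /(@lt_normP R _ Tx q j q0)[k kj lt1] /(@norm_ltP R _ Tx q' j q'0) lt2] <-].
have v1 : valid_rat (rat_code q) by apply/valid_ratP; exists q.
have v2 : valid_rat (rat_code q') by apply/valid_ratP; exists q'.
rewrite /diagc /triple_code !(pleftK, prightK); apply/and4P; split=> //.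
  apply/hasP; exists k; first by rewrite mem_iota.
  by rewrite rat_lt_absP ?valid_gt0// ratval_code.
apply/allP => i; rewrite mem_iota /= => ij.
by rewrite abs_lt_ratP ?valid_gt0// ratval_code// lt2.
Qed.

Lemma recfun_polyc x n j : recfun x -> recfun n -> recfun j ->
  recfun (fun y => polyc (x y) (n y) (j y)).
Proof.
move=> cx cn cj.
have step : recfun3 polystep.
  have cl x' n' l : recfun x' -> recfun n' -> recfun l ->
      recpred (fun y => letterc (x' y) (n' y) (l y)).
    move=> cx' cn' cl; rewrite /letterc; rec_auto => //.
    exact: (recfun2_app recT cx' cn').
  have cf s c : recfun s -> recfun c -> recfun (fun y => fracadd (s y) (c y)).
    by move=> cs cc; rewrite /fracadd; rec_auto.
  rewrite /recfun3 /polystep; apply: recfun_if; last by rec_auto.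
    rewrite /wordc; apply: recpred_and; first by apply: cl; rec_auto.
    apply: recpred_all_decode; last by apply: cl; rec_auto.
    by rec_auto.
  by apply: recfun_pair; apply: cf; rec_auto.
have c' : recfun2 (fun y j => foldl (polystep y) ⟪⟪0, ⟪0, 1⟫⟫, ⟪0, ⟪0, 1⟫⟫⟫%N (CodeSeq.decode j)).
  apply: recfun_foldl; [|exact: recfun_const|by rec_auto].
  apply: (recfun3_app step); by rec_auto.
by apply: (recfun2_app c'); rec_auto.
Qed.

Lemma recpred_diagc : recpred (fun y => diagc (pleft y) (pright y)).
Proof.
rewrite /diagc; cbv zeta.
have cv r : recfun r -> recpred (fun y => valid_rat (r y)).
  move=> cr; apply: (recfun_comp (f := fun r => valid_rat r)) => //.
  by rewrite /valid_rat /dvdc; rec_auto.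
have clt r s : recfun r -> recfun s -> recpred (fun y => rat_lt_abs (r y) (s y)).
  move=> cr cs.
  apply: (@recfun2_app (fun r s => rat_lt_abs r s)) => //.
  by rewrite /recfun2 /rat_lt_abs /abs2den /abs2num /fracabs /denim /denre; rec_auto.
have clt' r s : recfun r -> recfun s -> recpred (fun y => abs_lt_rat (r y) (s y)).
  move=> cr cs.
  apply: (@recfun2_app (fun r s => abs_lt_rat r s)) => //.
  by rewrite /recfun2 /abs_lt_rat /abs2den /abs2num /fracabs /denim /denre; rec_auto.
apply: recpred_and; first by apply: cv; rec_auto.
apply: recpred_and; first by apply: cv; rec_auto.
apply: recpred_and.
  apply: recpred_has; first by rec_auto.
  by apply: clt; [rec_auto|apply: recfun_polyc; rec_auto].
apply: recpred_all; first by rec_auto.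
by apply: clt'; [rec_auto|apply: recfun_polyc; rec_auto].
Qed.

End Decision.

(** * Non-uniformity *)

(** The stage [s = ⟪t, v⟫] carries both the derivation and the value, so that the value is at most
    [s]. *)
Definition self_halts (x s : nat) : bool := computes (pleft s) x x (pright s).

Definition self_halts_first (x s : nat) : bool :=
  self_halts x s && all (fun s' => ~~ self_halts x s') (iota 0 s).

Lemma self_halts_first_atmost1 x : atmost1 (self_halts_first x).
Proof.
move=> m n /andP[hm /allP fm] /andP[hn /allP fn].
have memI i k : (i < k)%N -> i \in iota 0 k by rewrite mem_iota.
case: (ltngtP m n) => // [/memI/fn|/memI/fm]; first by rewrite hm.
by rewrite hn.
Qed.

Lemma recpred_self_halts_first :
  recfun2 (fun x s => self_halts_first x s).
Proof.
have c : recfun2 (fun x s => self_halts x s).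
  by apply: recpred_computes; rec_auto.
apply: recpred_and => //; apply: recpred_all; first by rec_auto.
by apply: recpred_neg; apply: (recfun2_app c); rec_auto.
Qed.

(** The s-m-n theorem: [x] is hardwired by composing [c] with a constant program, and the Gödel
    number of the latter is primitive recursive in [x]. *)
Lemma index_of_curried (c : Defs.code) (f : nat -> nat -> nat) :
  (forall z, denote c z (f (pleft z) (pright z))) ->
  exists2 e, recfun e & forall x, index_of (e x) (f x).
Proof.
move=> cf; pose d x := CComp c (CPair (code_const x) code_id).
exists (fun x => godel (d x)); last first.
  move=> x n; exists (d x) => //=; exists ⟪x, n⟫.
    by exists x, n; split=> //; [exact: denote_const|exact: denote_id].
  by have := cf ⟪x, n⟫; rewrite pleftK prightK.
have cc : recfun (fun x => godel (code_const x)).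
  have step : recfun3 (fun _ _ y => ⟪5, ⟪godel CSucc, y⟫⟫%N) by rewrite /recfun3; rec_auto.
  have := recfun_iterate (recfun_const (godel CZero)) recfun_id step.
  by congr recfun; apply/funext; elim=> //= x ->.
rewrite /d /=; do ! (apply: recfun_pair; first exact: recfun_const).
by apply: recfun_pair; [exact: cc|exact: recfun_const].
Qed.

Section NonUniformity.
Variable R : realType.

Let P x : presentation (cseq R) := pres R (@self_halts_first_atmost1 x).
Let D := diagc self_halts_first.

(** Provides a default output for the enumerations of all the diagrams. The witness is [u_0], of
    norm 1, with the bounds 1/2 and 2. *)
Lemma common_diagram_element : exists z, forall x, D x z.
Proof.
have [j jE] := starpoly_enum_surj [:: (1, ((0%N, false), [::]))].
have vE x k : polyval (self_halts_first x) k (starpoly_enum j) =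
    if self_halts_first x k then 0 else 1.
  by rewrite jE /polyval big_seq1 /wordb /= andbT; case: (self_halts_first x k).
have abs0 : abs2 0 = 0 by rewrite /abs2 /= expr0n addr0.
have abs1 : abs2 1 = 1 by rewrite /abs2 /= expr0n addr0 expr1n.
exists (triple_code (2^-1, j, 2)) => x.
apply/(diagcP R (@self_halts_first_atmost1 x)); exists (2^-1, j, 2) => //.
split=> //.
  apply/lt_normP => //.
  (* The derivation coded by 0 is empty, so 0 is never exceptional. *)
  have x0 : self_halts_first x 0 = false by [].
  by exists 0%N => //; rewrite vE x0 abs1.
apply/norm_ltP => // k _; rewrite vE; case: ifP => _; first by rewrite abs0.
by rewrite abs1.
Qed.

(** The diagram is decidable uniformly in [x]: its name sends each member to itself and everything
    else to the default [z0]. *)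
Lemma uniform_index : exists2 e, recfun e & forall x, presentation_index (P x) (e x).
Proof.
have [z0 z0D] := common_diagram_element.
pose f x n := if D x n then n else z0.
have [c cf] : recfun2 f.
  rewrite /recfun2 /f; apply: recfun_if; [|by rec_auto|exact: recfun_const].
  exact: recpred_diagc recpred_self_halts_first.
have [e ce ef] := index_of_curried cf; exists e => // x; exists (f x) => //.
rewrite /is_name eqEsubset; split=> [_ [n _ <-]|z].
  have /(diagcP R (@self_halts_first_atmost1 x)) : D x (f x n).
    by rewrite /f; case: ifP.
  by move=> [t dt tE]; exists t.
move=> [t dt <-]; exists (triple_code t) => //; rewrite /f ifT//.
by apply/(diagcP R (@self_halts_first_atmost1 x)); exists t.
Qed.

Lemma cseq_not_uniformly_unital : ~ uniformly_computably_unital (cseq_one R).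
Proof.
move=> [a aP]; have [e re eP] := uniform_index.
have /choice[i iP] : forall x, exists i, phi a (e x) i /\ vector_index (P x) (cseq_one R) i.
  by move=> x; have [i ? ?] := aP _ _ (eP x); exists i.
(* [a] is a Gödel number because [phi a] is defined at [e 0]. *)
have [ca caE] : exists c, godel c = a by case: (iP 0%N) => -[c]; exists c.
have [ce ceP] := re.
have ri : recfun i.
  exists (CComp ca ce) => x /=; exists (e x) => //.
  have [[c cE cx] _] := iP x.
  by rewrite -caE in cE; rewrite -(godel_inj cE).
have /choice[m mP] : forall x, exists m, phi (i x) 1 m /\
    `|rational_vector (P x) m - cseq_one R| < (2 ^- 1 : R[i]).
  by move=> x; have [_ [f fi fP]] := iP x; exists (f 1%N).
(* Although [m] was obtained by choice, [m x] is the only value of program [i x] at 1, so a search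
   for derivations recovers it. *)
have [||g rg gP] := @recfun_mu (fun x s => computes (pleft s) (i x) 1 (pright s)).
- by apply: recpred_computes; [|apply: (recfun_comp ri)| |]; rec_auto.
- move=> x; have [[c <- /computesP[t ct]] _] := mP x.
  by exists ⟪t, m x⟫; rewrite pleftK prightK.
have [b bP] : recfun m.
  have := recfun_right rg; congr recfun; apply/funext => x.
  have [[c cE cm] _] := mP x.
  by apply: denote_fun cm; apply/computesP; exists (pleft (g x)); rewrite cE.
(* The diagonal argument: [m x] is the value of program [x] at [x], so a stage of self-halting
   exists and the least one is exceptional for [P x]. *)
pose x := godel b.
have [s0 s0x] : exists s, self_halts x s.
  have /computesP[t tx] := bP x.
  by exists ⟪t, m x⟫; rewrite /self_halts pleftK prightK.
have [s sx smin] := ex_minnP (ex_intro _ s0 s0x).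
have sfirst : self_halts_first x s.
  rewrite /self_halts_first sx; apply/allP => k; rewrite mem_iota /= add0n => ks.
  by apply/negP => /smin; rewrite leqNgt ks.
have ms : (m x <= s)%N.
  have -> : m x = pright s; last exact: pright_le.
  by apply: denote_fun (bP x) _; apply/computesP; exists (pleft s).
exact: polyval_exceptional_far ms sfirst (mP x).2.
Qed.

End NonUniformity.

Theorem theorem5p3 (R : realType) :
  exists (A : cstarAlgType R) (one : A),
    [/\ commutative (@cmul R A), is_cunit one,
        computably_presentable A
      & ~ uniformly_computably_unital one].
Proof.
exists (cseq R), (cseq_one R); split.
- exact: cseq_cmulC.
- exact: cseq_unit.
(* Any parameter gives a computable presentation; 0 is taken. *)
- have [e _ /(_ 0%N)[f fe fn]] := uniform_index R.
  by exists (pres R (@self_halts_first_atmost1 0)); exists f => //; exists (e 0%N).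
- exact: cseq_not_uniformly_unital.
Qed.
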